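(* Let $\mathcal{A}$ and $\mathcal{B}$ be finite training and test datasets of $N$-qubit quantum states, all of whose states are independently sampled from state 2-designs. Let $O$ be an observable (Hermitian operator on $N$ qubits) with $\mathrm{Tr}[O]=0$, let $U$ be a target unitary drawn from a unitary 2-design on $N$ qubits, independently of the data, and let each state $\rho$ in $\mathcal{A}\cup\mathcal{B}$ carry the label $y:=\mathrm{Tr}[O U\rho U^\dagger]$. Let $\mathcal{L}_{\mathcal{A}}(t)$ and $\mathcal{L}_{\mathcal{B}}(t)$ be the training and the test loss of the quantum neural network with predictions $z(\bm\theta)=\mathrm{Tr}[V(\bm\theta)^\dagger O V(\bm\theta)\rho]$ at training step $t$, where $t=\infty$ denotes the end of training. Then, under the frozen QNTK regime, $$\mathbb{E}\,\mathcal{L}_{\mathcal{B}}(\infty)\ \ge\ \Big(1-\frac{|\mathcal{A}|}{2^{2N}-1}\Big)\,\mathbb{E}\,\mathcal{L}_{\mathcal{B}}(0),$$ where the expectation is taken over the 2-design distributions of the states in $\mathcal{A}$ and $\mathcal{B}$ and of the target unitary $U$.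
   Context: A random pure state $\rho=W|0\rangle\langle 0|W^\dagger$ is sampled from a state 2-design if $W\in\mathcal{U}(2^N)$ is sampled from a unitary 2-design, i.e. a distribution on $\mathcal{U}(2^N)$ whose moments of degree at most 2 in the entries of $W$ and at most 2 in their conjugates agree with those of the Haar measure. Quantum neural network: $V(\bm\theta)=\prod_{d=D}^{1}\exp(-iH_d\theta_d/2)W_d$ with $\bm\theta\in\mathbb{R}^D$ (the factor $d=D$ is leftmost), where each $H_d$ is both Hermitian and unitary and each $W_d$ is a fixed unitary. For a sample $a=(\rho_a,y_a)$ the prediction is $z_a(\bm\theta)=\mathrm{Tr}[V(\bm\theta)^\dagger O V(\bm\theta)\rho_a]$ and the residual is $r_a(\bm\theta)=z_a(\bm\theta)-y_a$. The loss on a dataset $\mathcal{X}$ is $\mathcal{L}_{\mathcal{X}}(\bm\theta)=\frac{1}{2|\mathcal{X}|}\sum_{a\in\mathcal{X}} r_a(\bm\theta)^2$. Write $z_a(t)$, $r_a(t)$, $\mathcal{L}_{\mathcal{X}}(t)$ for the values at the training parameter $\bm\theta(t)$; the initial parameter $\bm\theta(0)$ is fixed (non-random). Let $J_{da}=\frac{\partial z_a}{\partial\theta_d}(\bm\theta(0))$ for $a\in\mathcal{A}\cup\mathcal{B}$, let $\tilde K_{ab}=\frac1D\sum_{d=1}^D J_{da}J_{db}$ be the quantum neural tangent kernel (QNTK) on $\mathcal{A}\cup\mathcal{B}$, and let $K$ be its restriction to $\mathcal{A}\times\mathcal{A}$, assumed invertible. The frozen QNTK regime means that the QNTK stays equal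 to its initial value throughout training and the training loss is driven to zero, so that after training the prediction on a test sample $\hat b\in\mathcal{B}$ is $$z_{\hat b}(\infty)=z_{\hat b}(0)-\sum_{a,a'\in\mathcal{A}}\tilde K_{\hat b a'}[K^{-1}]_{a'a}\,r_a(0),$$ and $\mathcal{L}_{\mathcal{B}}(\infty)=\frac{1}{2|\mathcal{B}|}\sum_{\hat b\in\mathcal{B}}(z_{\hat b}(\infty)-y_{\hat b})^2$. *)

(* Defs.v *)
From HB Require Import structures.
From mathcomp Require Import all_boot all_order all_algebra.
From mathcomp Require Import all_classical all_reals all_analysis.
From mathcomp Require Export complex.

Set Implicit Arguments.
Unset Strict Implicit.
Unset Printing Implicit Defensive.

Import Order.TTheory GRing.Theory Num.Theory.
Import numFieldNormedType.Exports.

Local Open Scope classical_set_scope.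
Local Open Scope ring_scope.
Local Open Scope sesquilinear_scope.

HB.instance Definition _ (R : realType) := isPointed.Build R[i] 0.

(* Generated by the real and imaginary parts of the entries, hence the Borel
   sigma-algebra of 'M[R[i]]_n. *)
Definition mx_cylinder (R : realType) (n : nat) : set (set 'M[R[i]]_n) :=
  [set E | exists (i j : 'I_n) (B : set R), measurable B /\
     (E = [set M : 'M[R[i]]_n | B (complex.Re (M i j))] \/
      E = [set M : 'M[R[i]]_n | B (complex.Im (M i j))])].

Definition cmx (R : realType) (n : nat) := g_sigma_algebraType (@mx_cylinder R n).

(* The Haar measure of U(n), viewed as a Borel probability on n x n matrices
   carried by U(n). *)
Definition is_haar (R : realType) (n : nat) (mu : probability (cmx R n) R) : Prop :=
  mu [set M | (M : 'M[R[i]]_n) \is unitarymx] = 1%E /\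
  forall (V : 'M[R[i]]_n) (E : set (cmx R n)),
    V \is unitarymx -> measurable E ->
    mu ((fun M : 'M[R[i]]_n => V *m M) @^-1` E) = mu E.

(* s lists (with repetition) the entries, s' the conjugated entries. *)
Definition entry_monomial (R : realType) (n : nat) (s s' : seq ('I_n * 'I_n))
    (M : 'M[R[i]]_n) : R[i] :=
  (\prod_(p <- s) M p.1 p.2) * (\prod_(p <- s') (M p.1 p.2)^*).

Definition unitary_2design (R : realType) (n : nat)
    (mu : probability (cmx R n) R) : Prop :=
  mu [set M | (M : 'M[R[i]]_n) \is unitarymx] = 1%E /\
  exists2 haar : probability (cmx R n) R, is_haar haar &
    forall s s' : seq ('I_n * 'I_n), (size s <= 2)%N -> (size s' <= 2)%N ->
      ('E_mu[fun M => complex.Re (entry_monomial s s' M)] =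
       'E_haar[fun M => complex.Re (entry_monomial s s' M)])%E /\
      ('E_mu[fun M => complex.Im (entry_monomial s s' M)] =
       'E_haar[fun M => complex.Im (entry_monomial s s' M)])%E.

Fact ket0_subproof (N : nat) : (0 < 2 ^ N)%N.
Proof. by rewrite expn_gt0. Qed.

Definition ket0 (N : nat) : 'I_(2 ^ N) := Ordinal (ket0_subproof N).

Definition state_of (R : realType) (N : nat) (W : 'M[R[i]]_(2 ^ N)) :
    'M[R[i]]_(2 ^ N) :=
  W *m delta_mx (ket0 N) (ket0 N) *m W ^t*.

Definition state_2design (R : realType) (N : nat)
    (nu : probability (cmx R (2 ^ N)) R) : Prop :=
  exists2 mu : probability (cmx R (2 ^ N)) R, unitary_2design mu &
    forall E : set (cmx R (2 ^ N)), measurable E ->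
      nu E = mu (@state_of R N @^-1` E).

Definition mutually_independent (R : realType) (d d' : measure_display)
    (T : measurableType d) (T' : measurableType d') (P : probability T R)
    (I : finType) (X : I -> T -> T') : Prop :=
  forall (J : {set I}) (E : I -> set T'),
    (forall i, i \in J -> measurable (E i)) ->
    P (\bigcap_(i in [set` J]) (X i @^-1` E i)) =
    (\prod_(i in J) P (X i @^-1` E i))%E.

(* exp A as the limit of the power series, taken on real and imaginary parts of
   the entries because R[i] carries no topology in the library. *)
Definition mexp_sum (R : realType) (n : nat) (A : 'M[R[i]]_n) (k : nat) :
    'M[R[i]]_n :=
  \sum_(l < k) (l`!%:R^-1 : R[i]) *: A ^+ l.

Definition mexp (R : realType) (n : nat) (A : 'M[R[i]]_n) : 'M[R[i]]_n :=
  \matrix_(i, j)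
    Complex (limn (fun k => complex.Re (mexp_sum A k i j)))
            (limn (fun k => complex.Im (mexp_sum A k i j))).

(* rev_ord puts the layer of largest index leftmost. *)
Definition qnn (R : realType) (n D : nat) (H W : 'I_D -> 'M[R[i]]_n)
    (theta : 'rV[R]_D) : 'M[R[i]]_n :=
  \prod_(d < D)
    (mexp ((0 -i* (theta 0 (rev_ord d) / 2))%C *: H (rev_ord d))
       *m W (rev_ord d)).

(* The traces in the prediction and in the label are real when Obs is Hermitian
   and rho is a state; Re only serves to land in R. *)
Definition prediction (R : realType) (n D : nat) (Obs : 'M[R[i]]_n)
    (H W : 'I_D -> 'M[R[i]]_n) (theta : 'rV[R]_D) (rho : 'M[R[i]]_n) : R :=
  complex.Re (\tr ((qnn H W theta) ^t* *m Obs *m qnn H W theta *m rho)).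

Definition label (R : realType) (n : nat) (Obs U rho : 'M[R[i]]_n) : R :=
  complex.Re (\tr (Obs *m U *m rho *m U ^t*)).

Definition residual (R : realType) (n D : nat) (Obs : 'M[R[i]]_n)
    (H W : 'I_D -> 'M[R[i]]_n) (theta : 'rV[R]_D) (U rho : 'M[R[i]]_n) : R :=
  prediction Obs H W theta rho - label Obs U rho.

Definition loss (R : realType) (n : nat) (r : 'I_n -> R) : R :=
  (2 * n%:R)^-1 * \sum_(a < n) r a ^+ 2.

Definition dprediction (R : realType) (n D : nat) (Obs : 'M[R[i]]_n)
    (H W : 'I_D -> 'M[R[i]]_n) (theta : 'rV[R]_D) (d : 'I_D)
    (rho : 'M[R[i]]_n) : R :=
  'D_(delta_mx 0 d) (fun t : 'rV[R]_D => prediction Obs H W t rho) theta.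

Definition qntk (R : realType) (n D k : nat) (Obs : 'M[R[i]]_n)
    (H W : 'I_D -> 'M[R[i]]_n) (theta : 'rV[R]_D)
    (rho : 'I_k -> 'M[R[i]]_n) : 'M[R]_k :=
  \matrix_(a, b) (D%:R^-1 *
    \sum_(d < D) dprediction Obs H W theta d (rho a) * dprediction Obs H W theta d (rho b)).

(* Samples are indexed by 'I_(m + n): the first m are the training samples, the
   last n the test samples. K is the kernel on all of them, so that ulsubmx K
   is its restriction to the training set; z and r are the initial predictions
   and residuals. *)
Definition frozen_prediction (R : realType) (m n : nat) (K : 'M[R]_(m + n))
    (z r : 'I_(m + n) -> R) (b : 'I_n) : R :=
  z (rshift m b) -
  \sum_(a < m) \sum_(a' < m)
    K (rshift m b) (lshift n a') * invmx (ulsubmx K) a' a * r (lshift n a).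

(* Main.v *)
(* The derivatives of the evolved observable M = V^* Obs V are Hermitian,
   traceless and Hilbert-Schmidt orthogonal to M, because Tr M and Tr M^2 do not
   depend on the parameters.  The frozen kernel therefore predicts on a test
   state x the value Tr[(M - L) x], where L = \sum_a r_a Lam_a and the operators
   Lam_a depend on the training states only, are orthogonal to M and satisfy
   Tr[Lam_a rho_a] = 1.  With X = U^* Obs U, averaging over the
   test state turns the squared error into a multiple of |M - L - X|^2, and
   averaging over U evaluates the cross term 2 Tr[X L] to
   -2 (Tr Obs^2 / (4^N - 1)) \sum_a Tr[Lam_a rho_a] = -2 m Tr Obs^2 / (4^N - 1),
   whereas |L|^2 >= 0 and |M - X|^2 averages to 2 Tr Obs^2.
   Only the average over U and the test state is expanded, so no integrability
   of the inverse kernel is required. *)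

(* The constant 4^N - 1 is the real dimension of the space of traceless Hermitian matrices. To
   second order, X = U^* Obs U is an isotropic random vector of that space, so each unit direction
   carries on average the share Tr Obs^2 / (4^N - 1) of |X|^2; Tr[Lam_a rho_a] = 1 is a diagonal
   entry of K K^-1. A design is given only by its moments and the Haar measure only by left
   invariance. The mean of Tr[A M B M^*] Tr[A' M B' M^*] is therefore found by symmetry: it is a
   unitarily invariant bilinear form in (A, A'). The spectral theorem and the permutation matrices
   leave two unknown constants, which are fixed by two combinations whose integrand is constant on
   the unitary group. The order of integration is forced by the uncontrolled size of K^-1: the test
   state first, then U, both with the training states frozen, and always with nonnegative
   integrands. The initial loss is the same computation with all Lam_a = 0, where the discarded term
   |L|^2 vanishes and the result is an equality. *)
Require Import Defs.
From HB Require Import structures.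
From mathcomp Require Import all_boot all_order all_algebra perm.
From mathcomp Require Import all_classical all_reals all_analysis.
From mathcomp Require Import measurable_realfun ring.

Set Implicit Arguments.
Unset Strict Implicit.
Unset Printing Implicit Defensive.

Import Order.TTheory GRing.Theory Num.Theory.
Import numFieldNormedType.Exports.

Local Open Scope classical_set_scope.
Local Open Scope ring_scope.
Local Open Scope sesquilinear_scope.

(** * Unitarily invariant bilinear forms *)

Section HermitianMatrices.
Variables (C : numClosedFieldType) (n : nat).
Implicit Types A B V : 'M[C]_n.

Lemma hermsymmxP A : reflect (A ^t* = A) (A \is hermsymmx).
Proof.
rewrite is_hermitianmxE expr0 scale1r eq_sym; exact: eqP.
Qed.

Lemma trmxCM A B : (A *m B) ^t* = B ^t* *m A ^t*.
Proof. by rewrite trmx_mul map_mxM. Qed.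

Lemma trmxCD A B : (A + B) ^t* = A ^t* + B ^t*.
Proof. by rewrite linearD /= map_mxD. Qed.

Lemma trmxCZ c A : (c *: A) ^t* = c^* *: A ^t*.
Proof. by rewrite linearZ /= map_mxZ. Qed.

Lemma unitarymx_mulCV V : V \is unitarymx -> V ^t* *m V = 1%:M.
Proof. by move=> uV; apply/mulmx1C/unitarymxP. Qed.

Lemma unitarymx_perm (s : 'S_n) : (perm_mx s : 'M[C]_n) \is unitarymx.
Proof.
apply/unitarymxP.
by rewrite tr_perm_mx map_perm_mx -perm_mxM mulgV perm_mx1.
Qed.

Lemma perm_conj_delta (s : 'S_n) (i j : 'I_n) :
  (perm_mx s) ^t* *m delta_mx i j *m perm_mx s = delta_mx (s i) (s j) :> 'M[C]_n.
Proof.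
rewrite tr_perm_mx map_perm_mx -row_permE -[X in _ *m perm_mx X]invgK -col_permE.
apply/matrixP => k l; rewrite !mxE.
by rewrite -[_ k == i](inj_eq (@perm_inj _ s)) -[_ l == j](inj_eq (@perm_inj _ s)) !permKV.
Qed.

Lemma mxtrace_delta_mul (i j k l : 'I_n) :
  \tr (delta_mx i j *m delta_mx k l) = ((j == k) && (i == l))%:R :> C.
Proof.
rewrite mul_delta_mx_cond; have [_|_] := eqVneq j k; last by rewrite mulr0n raddf0.
rewrite mulr1n /mxtrace (bigD1 l) //= big1 ?addr0; last first.
  by move=> x /negbTE xl; rewrite mxE xl andbF.
by rewrite mxE eqxx andbT eq_sym.
Qed.

Lemma mxtrace_hermitian_mul A B : A \is hermsymmx -> B \is hermsymmx ->
  (\tr (A *m B))^* = \tr (A *m B).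
Proof.
move=> /hermsymmxP hA /hermsymmxP hB.
rewrite -[LHS]trace_map_mx -[LHS]mxtrace_tr map_trmx.
by rewrite trmxCM hA hB mxtrace_mulC.
Qed.

Lemma mxtrace_hermitian_sqr_ge0 A : A \is hermsymmx -> 0 <= \tr (A *m A).
Proof.
move=> /hermsymmxP hA; apply: sumr_ge0 => i _; rewrite mxE.
apply: sumr_ge0 => j _; rewrite -{2}hA !mxE; exact: mul_conjC_ge0.
Qed.

End HermitianMatrices.

Section InvariantBilinear.
Variables (C : numClosedFieldType) (n : nat) (F : 'M[C]_n -> 'M[C]_n -> C).
Hypothesis F_linl : forall B, scalar (F ^~ B).
Hypothesis F_linr : forall A, scalar (F A).
Hypothesis F_inv : forall V A B, V \is unitarymx ->
  F (V ^t* *m A *m V) (V ^t* *m B *m V) = F A B.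

Let F_D A A' B : F (A + A') B = F A B + F A' B.
Proof. by have := F_linl B 1 A A'; rewrite scale1r mul1r. Qed.

Let F_Dr A B B' : F A (B + B') = F A B + F A B'.
Proof. by have := F_linr A 1 B B'; rewrite scale1r mul1r. Qed.

Let F0 A : F 0 A = 0.
Proof. by apply: (addIr (F 0 A)); rewrite -F_D addr0 add0r. Qed.

Let F0r A : F A 0 = 0.
Proof. by apply: (addIr (F A 0)); rewrite -F_Dr addr0 add0r. Qed.

Let F_Z c A B : F (c *: A) B = c * F A B.
Proof. by have := F_linl B c A 0; rewrite F0 !addr0. Qed.

Let F_Zr c A B : F A (c *: B) = c * F A B.
Proof. by have := F_linr A c B 0; rewrite F0r !addr0. Qed.

Let F_sum (I J : finType) (c : I -> C) (A : I -> 'M[C]_n) (d : J -> C)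
    (B : J -> 'M[C]_n) :
  F (\sum_i c i *: A i) (\sum_j d j *: B j) =
  \sum_i \sum_j c i * d j * F (A i) (B j).
Proof.
rewrite (big_morph (F ^~ _) (fun X Y => F_D X Y _) (F0 _)).
apply: eq_bigr => i _; rewrite (big_morph (F _) (F_Dr _) (F0r _)).
by apply: eq_bigr => j _; rewrite F_Z F_Zr mulrA.
Qed.

Let e (i : 'I_n) : 'M[C]_n := delta_mx i i.

Let F_perm (s : 'S_n) (i j k l : 'I_n) :
  F (delta_mx (s i) (s j)) (delta_mx (s k) (s l)) = F (delta_mx i j) (delta_mx k l).
Proof. by rewrite -!perm_conj_delta F_inv// unitarymx_perm. Qed.

Let F_eq i j : F (e i) (e i) = F (e j) (e j).
Proof. by rewrite -(F_perm (tperm i j)) !tpermL. Qed.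

(** The symmetric group acts transitively on ordered pairs of distinct indices. The transposition of
    [i] and [k] moves the pair to (k, j') with j' different from k, and the transposition of [j']
    and [l] then fixes k. *)
Let F_neq i j k l : i != j -> k != l -> F (e i) (e j) = F (e k) (e l).
Proof.
move=> ij kl; rewrite -(F_perm (tperm i k)) tpermL.
set j' := tperm i k j.
have kj' : k != j' by rewrite -(tpermL i k) (inj_eq perm_inj).
rewrite -(F_perm (tperm j' l)) !tpermL.
by rewrite tpermD// eq_sym.
Qed.

Section TwoIndices.
Variables (i0 i1 : 'I_n).
Hypothesis i01 : i0 != i1.

Let a := F (e i0) (e i0).
Let b := F (e i0) (e i1).

Let F_ee i j : F (e i) (e j) = (a - b) *+ (i == j) + b.
Proof.
have [->|ij] := eqVneq i j; first by rewrite mulr1n subrK; exact: F_eq.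
by rewrite mulr0n add0r; apply: F_neq.
Qed.

(* diagonalizing A reduces F A A to the values of F at the diagonal units *)
Let F_herm A : A \is hermsymmx ->
  F A A = (a - b) * \tr (A *m A) + b * \tr A ^+ 2.
Proof.
move=> /hermitian_normalmx /orthomx_spectralP.
have uP := spectral_unitarymx A.
rewrite invmx_unitary//; set P := spectralmx A; set d := spectral_diag A => AE.
have -> : F A A = F (diag_mx d) (diag_mx d) by rewrite AE F_inv.
have -> : \tr A = \sum_i d 0 i.
  by rewrite AE mxtrace_mulC mulmxA (unitarymxP uP) mul1mx mxtrace_diag.
have -> : \tr (A *m A) = \sum_i d 0 i ^+ 2.
  rewrite {1}AE -!mulmxA mxtrace_mulC -!mulmxA.
  have -> : P *m (A *m P ^t*) = diag_mx d.
    rewrite AE !mulmxA (unitarymxP uP) mul1mx -!mulmxA.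
    by rewrite (unitarymxP uP) mulmx1.
  by rewrite mulmx_diag mxtrace_diag; apply: eq_bigr => i _; rewrite mxE expr2.
rewrite diag_mx_sum_delta F_sum expr2 big_distrlr /= !mulr_sumr -big_split /=.
apply: eq_bigr => i _; rewrite mulr_sumr.
under eq_bigr do rewrite -/(e _) -/(e _) F_ee mulrDr.
rewrite big_split /=; congr (_ + _).
  rewrite (bigD1 i)//= eqxx big1 ?addr0 ?mulr1n ?expr2 1?mulrC//.
  by move=> j ji; rewrite eq_sym (negbTE ji) mulr0n mulr0.
by apply: eq_bigr => j _; rewrite mulrC.
Qed.

Let hermsymmx_re i j : (delta_mx i j + delta_mx j i : 'M[C]_n) \is hermsymmx.
Proof.
apply/hermsymmxP; apply/matrixP => k l; rewrite !mxE rmorphD /= !conjC_nat.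
by rewrite addrC (andbC (l == j)) (andbC (l == i)).
Qed.

Let hermsymmx_im i j :
  ('i *: (delta_mx i j - delta_mx j i) : 'M[C]_n) \is hermsymmx.
Proof.
apply/hermsymmxP; apply/matrixP => k l; rewrite !mxE rmorphM rmorphB /= !conjC_nat.
by rewrite conjCi mulNr -mulrN opprB (andbC (l == j)) (andbC (l == i)).
Qed.

Let mxtrace_delta i j : \tr (delta_mx i j : 'M[C]_n) = (i == j)%:R.
Proof.
have := mxtrace_delta_mul C i j j j.
by rewrite mul_delta_mx eqxx.
Qed.

(* The Hermitian combinations E_ij + E_ji and i (E_ij - E_ji) recover
   the mixed values F E_ij E_ji. *)
Let F_swap i j : F (delta_mx i j) (delta_mx j i) + F (delta_mx j i) (delta_mx i j) =
  2 * (a - b) + 2 * b *+ (i == j).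
Proof.
have := F_herm (hermsymmx_re i j); have := F_herm (hermsymmx_im i j).
have := mxtrace_delta i j; have := mxtrace_delta j i.
have := mxtrace_delta_mul C i j i j; have := mxtrace_delta_mul C i j j i.
have := mxtrace_delta_mul C j i i j; have := mxtrace_delta_mul C j i j i.
rewrite !eqxx (eq_sym j i) /= !andbb.
move: (delta_mx i j) (delta_mx j i) => X Y.
rewrite F_Z F_Zr -scaleN1r !F_D !F_Dr !(F_Z (-1)) !(F_Zr (-1)).
rewrite -scalemxAl -scalemxAr !mulmxDl !mulmxDr -!scalemxAl -!scalemxAr.
rewrite !mxtraceD !mxtraceZ !mxtraceD !mxtraceZ.
move=> -> -> -> -> -> ->.
have iK (z : C) : 'i * ('i * z) = - z by rewrite mulrA -expr2 sqrCi mulN1r.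
rewrite !iK => h1 h2; apply: (mulfI (_ : 2 != 0 :> C)); first by rewrite pnatr_eq0.
have -> : 2 * (F X Y + F Y X) = F X X + F X Y + (F Y X + F Y Y)
  - (F X X + -1 * F X Y + (-1 * F Y X + -1 * (-1 * F Y Y))) by ring.
rewrite h1 h2; case: (i == j) => /=; rewrite ?mulr1n ?mulr0n; ring.
Qed.

(** By [F_herm] only c = a - b and b are unknown. The identity gives t = c q + b q^2 and the sum
    over swapped matrix units gives s = c q^2 + b q; this system has determinant q^3 - q up to a
    factor q and sign, and solving it yields c (q^3 - q) = q s - t and b (q^3 - q) = q t - s. *)
Lemma invariant_bilinear_hermitian A : A \is hermsymmx ->
  let t := F 1%:M 1%:M in
  let s := \sum_i \sum_j F (delta_mx i j) (delta_mx j i) in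
  let q := n%:R in
  (q ^+ 3 - q) * F A A =
  (q * s - t) * \tr (A *m A) + (q * t - s) * \tr A ^+ 2.
Proof.
move=> hA t s q; rewrite F_herm//.
have tE : t = (a - b) * q + b * q ^+ 2.
  have -> : t = F 1%:M 1%:M by [].
  rewrite F_herm ?mulmx1 ?mxtrace1//.
  by apply/hermsymmxP; rewrite trmx1 map_mx1.
have sE : s = (a - b) * q ^+ 2 + b * q.
  apply: (mulfI (_ : 2 != 0 :> C)); first by rewrite pnatr_eq0.
  have -> : 2 * s = \sum_(i < n) \sum_(j < n) (2 * (a - b) + 2 * b *+ (i == j)).
    rewrite mulr_natl mulr2n {2}/s exchange_big -big_split /=.
    by apply: eq_bigr => i _; rewrite -big_split; apply: eq_bigr => j _; exact: F_swap.
  under eq_bigr => i _.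
    rewrite big_split /= sumr_const card_ord (bigD1 i)//= eqxx big1 ?addr0; last first.
      by move=> j /negbTE ji; rewrite eq_sym ji.
    over.
  by rewrite sumr_const card_ord mulr1n -[X in X = _]mulr_natl -[_ *+ n]mulr_natl -/q; ring.
rewrite tE sE; ring.
Qed.

End TwoIndices.
End InvariantBilinear.

(** * Complex-valued measurable functions and integrals *)

Section BoundedMeasurable.
Variables (R : realType) (d : measure_display) (S : measurableType d).
Implicit Types (D : set S) (f g : S -> R[i]).

(* With D := set0 the boundedness is void and only measurability remains. *)
Definition bmeas D f := [/\ measurable_fun setT (fun x => complex.Re (f x)),
  measurable_fun setT (fun x => complex.Im (f x)) &
  exists c : R, forall x, D x -> Normc.normc (f x) <= c].

Lemma bmeas_set0 D f : bmeas D f -> bmeas set0 f.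
Proof. by move=> [? ? _]; split => //; exists 0. Qed.

Lemma bmeas_cst D c : bmeas D (fun=> c).
Proof. by split; [exact: measurable_cst|exact: measurable_cst|eexists]. Qed.

Lemma bmeasD D f g : bmeas D f -> bmeas D g -> bmeas D (fun x => f x + g x).
Proof.
move=> [f1 f2 [a fa]] [g1 g2 [b gb]]; split.
- under eq_fun do rewrite raddfD; exact: measurable_funD.
- under eq_fun do rewrite raddfD; exact: measurable_funD.
- exists (a + b) => x Dx; apply: le_trans (le_normcD _ _) _.
  by apply: lerD; [exact: fa|exact: gb].
Qed.

Lemma bmeasM D f g : bmeas D f -> bmeas D g -> bmeas D (fun x => f x * g x).
Proof.
move=> [f1 f2 [a fa]] [g1 g2 [b gb]]; split.
- rewrite (_ : (fun x => _) = fun x => complex.Re (f x) * complex.Re (g x)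
      - complex.Im (f x) * complex.Im (g x)).
    by apply: measurable_funB; apply: measurable_funM.
  by apply/funext => x; case: (f x) (g x) => [? ?] [].
- rewrite (_ : (fun x => _) = fun x => complex.Re (f x) * complex.Im (g x)
      + complex.Im (f x) * complex.Re (g x)).
    by apply: measurable_funD; apply: measurable_funM.
  by apply/funext => x; case: (f x) (g x) => [? ?] [].
- exists (a * b) => x Dx; rewrite Normc.normcM.
  apply: ler_pM; rewrite ?fa ?gb//; case: (f x) (g x) => [? ?] [? ?];
    exact: sqrtr_ge0.
Qed.

Lemma bmeas_conj D f : bmeas D f -> bmeas D (fun x => (f x)^*).
Proof.
move=> [f1 f2 [a fa]]; split.
- by rewrite (_ : (fun x => _) = fun x => complex.Re (f x))//;
    apply/funext => x; case: (f x).
- rewrite (_ : (fun x => _) = fun x => - complex.Im (f x)).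
    exact: measurableT_comp.
  by apply/funext => x; case: (f x).
- exists a => x /fa; case: (f x) => u v /=; by rewrite sqrrN.
Qed.

Lemma bmeasN D f : bmeas D f -> bmeas D (fun x => - f x).
Proof.
move=> mf; under eq_fun do rewrite -mulN1r.
by apply: bmeasM => //; exact: bmeas_cst.
Qed.

Lemma bmeasB D f g : bmeas D f -> bmeas D g -> bmeas D (fun x => f x - g x).
Proof. by move=> mf mg; apply: bmeasD => //; exact: bmeasN. Qed.

Lemma bmeas_sum D (I : finType) (f : I -> S -> R[i]) :
  (forall i, bmeas D (f i)) -> bmeas D (fun x => \sum_i f i x).
Proof.
move=> mf; elim: (index_enum I) => [|i r ih].
  by under eq_fun do rewrite big_nil; exact: bmeas_cst.
by under eq_fun do rewrite big_cons; exact: bmeasD.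
Qed.

Lemma bmeas_prod D (I : Type) (r : seq I) (f : I -> S -> R[i]) :
  (forall i, bmeas D (f i)) -> bmeas D (fun x => \prod_(i <- r) f i x).
Proof.
move=> mf; elim: r => [|i r ih].
  by under eq_fun do rewrite big_nil; exact: bmeas_cst.
by under eq_fun do rewrite big_cons; exact: bmeasM.
Qed.

Lemma bmeas_real D (f : S -> R) : measurable_fun setT f ->
  (exists c, forall x, D x -> `|f x| <= c) -> bmeas D (fun x => (f x)%:C%C).
Proof.
move=> mf [c fc]; split; [exact: mf|exact: (measurable_cst (0 : R))|].
by exists c => x /fc; rewrite /= expr0n addr0 sqrtr_sqr.
Qed.

Definition mbmeas D n (A : S -> 'M[R[i]]_n) :=
  forall i j, bmeas D (fun x => A x i j).

Lemma mbmeas_cst D n (A : 'M[R[i]]_n) : mbmeas D (fun=> A).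
Proof. by move=> i j; exact: bmeas_cst. Qed.

Lemma mbmeasD D n (A B : S -> 'M[R[i]]_n) :
  mbmeas D A -> mbmeas D B -> mbmeas D (fun x => A x + B x).
Proof.
by move=> mA mB i j; under eq_fun do rewrite mxE; apply: bmeasD.
Qed.

Lemma mbmeasB D n (A B : S -> 'M[R[i]]_n) :
  mbmeas D A -> mbmeas D B -> mbmeas D (fun x => A x - B x).
Proof.
by move=> mA mB i j; under eq_fun do rewrite !mxE; apply: bmeasB.
Qed.

Lemma mbmeasM D n (A B : S -> 'M[R[i]]_n) :
  mbmeas D A -> mbmeas D B -> mbmeas D (fun x => A x *m B x).
Proof.
move=> mA mB i j; under eq_fun do rewrite mxE.
by apply: bmeas_sum => k; apply: bmeasM.
Qed.

Lemma mbmeasZ D n (c : S -> R[i]) (B : S -> 'M[R[i]]_n) :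
  bmeas D c -> mbmeas D B -> mbmeas D (fun x => c x *: B x).
Proof.
by move=> mA mB i j; under eq_fun do rewrite mxE; apply: bmeasM.
Qed.

Lemma mbmeas_sum D n (I : finType) (A : I -> S -> 'M[R[i]]_n) :
  (forall k, mbmeas D (A k)) -> mbmeas D (fun x => \sum_k A k x).
Proof.
move=> mA i j; under eq_fun do rewrite summxE.
by apply: bmeas_sum => k; exact: mA.
Qed.

Lemma mbmeas_trmxC D n (A : S -> 'M[R[i]]_n) :
  mbmeas D A -> mbmeas D (fun x => (A x) ^t*).
Proof.
by move=> mA i j; under eq_fun do rewrite !mxE; apply: bmeas_conj.
Qed.

Lemma bmeas_mxtrace D n (A : S -> 'M[R[i]]_n) :
  mbmeas D A -> bmeas D (fun x => \tr (A x)).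
Proof. by move=> mA; apply: bmeas_sum. Qed.

(** The sigma-algebra is generated by the real and imaginary parts of the entries, so it is enough
    to test these; measurability of matrix expressions then follows from the closure properties of
    [bmeas]. *)
Lemma measurable_cmxP n (f : S -> cmx R n) :
  measurable_fun setT f <-> mbmeas set0 f.
Proof.
split=> [mf i j|mf].
  split; last by exists 0.
  - move=> _ B mB; have := mf measurableT [set M | B (complex.Re (M i j))].
    apply; apply: sub_sigma_algebra; exists i, j, B; split => //; by left.
  - move=> _ B mB; have := mf measurableT [set M | B (complex.Im (M i j))].
    apply; apply: sub_sigma_algebra; exists i, j, B; split => //; by right.
have mE : @measurable _ (cmx R n) = <<s @mx_cylinder R n >> by [].
have := @measurability _ _ S (cmx R n) setT f _ mE; apply.
move=> _ [_ [i [j [B [mB [->|->]]]]] <-]; have [f1 f2 _] := mf i j.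
- by have := f1 measurableT B mB.
- by have := f2 measurableT B mB.
Qed.

End BoundedMeasurable.

Section UnitarySet.
Variables (R : realType) (n : nat).

Definition unitary_set : set (cmx R n) := [set M : cmx R n | (M : 'M[R[i]]_n) \is unitarymx].

Lemma mbmeas_id0 : mbmeas set0 (fun M : cmx R n => M : 'M[R[i]]_n).
Proof. by apply/measurable_cmxP; exact: measurable_id. Qed.

(** The squared moduli in a row of a unitary matrix add up to 1. Hence every polynomial in the
    entries and their conjugates is bounded on the unitary group, and integrable for any probability
    carried by it. *)
Lemma unitarymx_normc_le1 (M : 'M[R[i]]_n) i j : M \is unitarymx ->
  Normc.normc (M i j) <= 1.
Proof.
move=> /unitarymxP /matrixP /(_ i i); rewrite !mxE eqxx => h.
have {h}h1 : _ = 1 := h.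
have : `|M i j| ^+ 2 <= 1.
  rewrite -[leRHS]h1 (bigD1 j)//= !mxE -normCK lerDl; apply: sumr_ge0 => k _.
  by rewrite !mxE -normCK; exact: exprn_ge0.
by rewrite expr_le1// lecR.
Qed.

Lemma mbmeas_id : mbmeas unitary_set (fun M : cmx R n => M : 'M[R[i]]_n).
Proof.
move=> i j; have [h1 h2 _] := mbmeas_id0 i j; split => //.
by exists 1 => M uM; exact: unitarymx_normc_le1.
Qed.

Lemma measurable_unitary_set : measurable unitary_set.
Proof.
pose A (M : cmx R n) : 'M[R[i]]_n := (M : 'M[R[i]]_n) *m (M : 'M[R[i]]_n) ^t* - 1%:M.
have mA : mbmeas set0 A.
  apply: mbmeasB; last exact: mbmeas_cst.
  by apply: mbmeasM; [|apply: mbmeas_trmxC]; exact: mbmeas_id0.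
have -> : unitary_set = \bigcap_(p in [set: 'I_n * 'I_n])
    ((fun M => complex.Re (A M p.1 p.2)) @^-1` [set 0] `&`
     (fun M => complex.Im (A M p.1 p.2)) @^-1` [set 0]).
  apply/seteqP; split => M /=.
    by move=> /unitarymxP uM p _ /=; rewrite /A uM subrr mxE.
  move=> h; apply/unitarymxP/eqP; rewrite -subr_eq0; apply/eqP/matrixP => i j.
  by have [/= h1 h2] := h (i, j) I; rewrite [RHS]mxE [LHS]complexE -/(A M) h1 h2 mulr0 addr0.
apply: fin_bigcap_measurable => // p _; have [h1 h2 _] := mA p.1 p.2.
by apply: measurableI; rewrite -[X in measurable X]setTI; [apply: h1|apply: h2].
Qed.

End UnitarySet.
Arguments unitary_set {R n}.

Lemma mxtrace_delta_mull (C : comNzRingType) n (i j : 'I_n) (X : 'M[C]_n) :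
  \tr (delta_mx i j *m X) = X j i.
Proof.
rewrite /mxtrace (bigD1 i)//= big1 ?addr0; last first.
  move=> k /negbTE ki; rewrite mxE big1// => l _.
  by rewrite mxE ki mul0r.
rewrite mxE (bigD1 j)//= big1 ?addr0; last first.
  by move=> l /negbTE lj; rewrite mxE lj andbF mul0r.
by rewrite mxE !eqxx mul1r.
Qed.

Section ComplexIntegral.
Variables (R : realType) (d : measure_display) (S : measurableType d).
Variable mu : probability S R.
Implicit Types (D : set S) (f g : S -> R[i]).

Definition Cint f : R[i] :=
  Complex (\int[mu]_x complex.Re (f x)) (\int[mu]_x complex.Im (f x)).

Lemma ae_full D : measurable D -> mu D = 1%E -> {ae mu, forall x, D x}.
Proof.
move=> mD D1; exists (~` D); split => //; first exact: measurableC.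
by rewrite probability_setC// D1 subee.
Qed.

Variable D : set S.
Hypotheses (mD : measurable D) (D1 : mu D = 1%E).

Lemma ae_bounded_integrable (h : S -> R) (c : R) : measurable_fun setT h ->
  (forall x, D x -> `|h x| <= c) -> mu.-integrable setT (EFin \o h).
Proof.
move=> mh hc; apply/integrableP; split; first exact/measurable_EFinP.
apply: le_lt_trans (_ : _ <= (`|c|)%:E * mu setT)%E _; last first.
  by rewrite probability_setT mule1 ltry.
apply: integral_le_bound => //; first exact/measurable_EFinP.
apply: filterS (ae_full mD D1) => x Dx _.
by rewrite lee_fin (le_trans (hc _ Dx))// ler_norm.
Qed.

Lemma le_Re_normc (z : R[i]) : `|complex.Re z| <= Normc.normc z.
Proof.
by case: z => x y /=; rewrite -sqrtr_sqr ler_sqrt ?lerDl ?addr_ge0 ?sqr_ge0.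
Qed.

Lemma le_Im_normc (z : R[i]) : `|complex.Im z| <= Normc.normc z.
Proof.
by case: z => x y /=; rewrite -sqrtr_sqr ler_sqrt ?lerDr ?addr_ge0 ?sqr_ge0.
Qed.

Lemma bmeas_integrable_Re f : bmeas D f ->
  mu.-integrable setT (EFin \o (fun x => complex.Re (f x))).
Proof.
move=> [mf _ [c fc]]; apply: (ae_bounded_integrable (c := c)) => // x Dx.
exact: le_trans (le_Re_normc _) (fc _ Dx).
Qed.

Lemma bmeas_integrable_Im f : bmeas D f ->
  mu.-integrable setT (EFin \o (fun x => complex.Im (f x))).
Proof.
move=> [_ mf [c fc]]; apply: (ae_bounded_integrable (c := c)) => // x Dx.
exact: le_trans (le_Im_normc _) (fc _ Dx).
Qed.

Lemma CintD f g : bmeas D f -> bmeas D g ->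
  Cint (fun x => f x + g x) = Cint f + Cint g.
Proof.
move=> mf mg; apply/eqP; rewrite eq_complex /=; apply/andP; split; apply/eqP.
- under eq_Rintegral do rewrite raddfD.
  by rewrite RintegralD//; exact: bmeas_integrable_Re.
- under eq_Rintegral do rewrite raddfD.
  by rewrite RintegralD//; exact: bmeas_integrable_Im.
Qed.

Lemma integrable_Zl (c : R) (h : S -> R) : mu.-integrable setT (EFin \o h) ->
  mu.-integrable setT (EFin \o (fun x => c * h x)).
Proof.
move=> ih; have := integrableZl measurableT c ih.
by apply: eq_integrable => // x _ /=; rewrite EFinM.
Qed.

Lemma CintZ c f : bmeas D f -> Cint (fun x => c * f x) = c * Cint f.
Proof.
move=> mf; have fR := bmeas_integrable_Re mf; have fI := bmeas_integrable_Im mf.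
case: c => a b; apply/eqP; rewrite eq_complex /=; apply/andP; split; apply/eqP.
- under eq_Rintegral => x _.
    rewrite (_ : complex.Re _ = a * complex.Re (f x) - b * complex.Im (f x)).
      over.
    by case: (f x).
  by rewrite RintegralB ?RintegralZl//; exact: integrable_Zl.
- under eq_Rintegral => x _.
    rewrite (_ : complex.Im _ = a * complex.Im (f x) + b * complex.Re (f x)).
      over.
    by case: (f x).
  by rewrite RintegralD ?RintegralZl//; exact: integrable_Zl.
Qed.

Lemma CintB f g : bmeas D f -> bmeas D g ->
  Cint (fun x => f x - g x) = Cint f - Cint g.
Proof.
move=> mf mg; have mNg := bmeasN mg.
rewrite CintD//; congr (_ + _).
by under [X in Cint X]eq_fun do rewrite -mulN1r; rewrite CintZ// mulN1r.
Qed.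

Lemma Cint_cst c : Cint (fun=> c) = c.
Proof.
rewrite /Cint !Rintegral_cst// (_ : fine _ = 1).
  by case: c => a b; rewrite /= !mulr1.
by rewrite -[RHS]/(fine 1%E) -(probability_setT mu).
Qed.

Lemma Cint_sum (I : finType) (f : I -> S -> R[i]) :
  (forall i, bmeas D (f i)) ->
  Cint (fun x => \sum_i f i x) = \sum_i Cint (f i).
Proof.
move=> mf.
suff : bmeas D (fun x => \sum_(i <- index_enum I) f i x) /\
    Cint (fun x => \sum_(i <- index_enum I) f i x) =
    \sum_(i <- index_enum I) Cint (f i) by case.
elim: (index_enum I) => [|i r [ih1 ih2]].
  under eq_fun do rewrite big_nil; split; first exact: bmeas_cst.
  by rewrite big_nil Cint_cst.
under eq_fun do rewrite big_cons; split; first exact: bmeasD.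
by rewrite big_cons CintD// ih2.
Qed.

(** This is what allows identities valid only for unitary matrices to be used under the integral,
    since [D] has full measure. *)
Lemma eq_Cint f g : bmeas set0 f -> bmeas set0 g ->
  (forall x, D x -> f x = g x) -> Cint f = Cint g.
Proof.
move=> [f1 f2 _] [g1 g2 _] fg; rewrite /Cint; congr Complex; congr fine.
- apply: ae_eq_integral => //; [exact/measurable_EFinP..|].
  by apply: filterS (ae_full mD D1) => x Dx _; rewrite fg.
- apply: ae_eq_integral => //; [exact/measurable_EFinP..|].
  by apply: filterS (ae_full mD D1) => x Dx _; rewrite fg.
Qed.

Lemma Re_Cint f : bmeas D f ->
  (\int[mu]_x (complex.Re (f x))%:E = (complex.Re (Cint f))%:E)%E.
Proof.
move=> mf; rewrite /= /Rintegral fineK//.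
exact/integrable_fin_num/bmeas_integrable_Re.
Qed.

Lemma Re_Cint_ge0 f : (forall x, 0 <= complex.Re (f x)) -> 0 <= complex.Re (Cint f).
Proof. by move=> f0; apply: Rintegral_ge0. Qed.

End ComplexIntegral.

(** * Second moments of unitary designs *)

Section SecondMoment.
Variables (R : realType) (n : nat).
Implicit Types (mu haar : probability (cmx R n) R) (M V A B : 'M[R[i]]_n).

(* Both averages are instances: the state average has B = B' = |0><0|, the target
   average has A = A' = Obs, since Tr[M^* Obs M B] = Tr[Obs M B M^*]. *)
Definition twirl A A' B B' M : R[i] :=
  \tr (A *m M *m B *m M ^t*) * \tr (A' *m M *m B' *m M ^t*).

(** Every monomial of the expansion has two entries and two conjugated entries, which is exactly the
    degree up to which a 2-design agrees with the Haar measure. *)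
Lemma twirlE A A' B B' M : twirl A A' B B' M =
  \sum_(p : 'I_n * 'I_n * ('I_n * 'I_n)) \sum_(p' : 'I_n * 'I_n * ('I_n * 'I_n))
    (A p.1.1 p.1.2 * B p.2.1 p.2.2 * (A' p'.1.1 p'.1.2 * B' p'.2.1 p'.2.2)) *
    entry_monomial [:: (p.1.2, p.2.1); (p'.1.2, p'.2.1)]
                   [:: (p.1.1, p.2.2); (p'.1.1, p'.2.2)] M.
Proof.
have trE X Y : \tr (X *m M *m Y *m M ^t*) =
    \sum_(p : 'I_n * 'I_n * ('I_n * 'I_n))
      X p.1.1 p.1.2 * Y p.2.1 p.2.2 * (M p.1.2 p.2.1 * (M p.1.1 p.2.2)^*).
  rewrite -(pair_bigA _ (fun p q => X p.1 p.2 * Y q.1 q.2 *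
    (M p.2 q.1 * (M p.1 q.2)^*))) /=.
  rewrite -(pair_bigA _ (fun i j => \sum_(q : 'I_n * 'I_n) X i j * Y q.1 q.2 *
    (M j q.1 * (M i q.2)^*))) /=.
  apply: eq_bigr => i _.
  transitivity (\sum_l \sum_k \sum_j X i j * Y k l * (M j k * (M i l)^*)).
    rewrite mxE; apply: eq_bigr => l _; rewrite 3!mxE mulr_suml.
    apply: eq_bigr => k _; rewrite mxE !mulr_suml.
    by apply: eq_bigr => j _; ring.
  rewrite exchange_big /= (eq_bigr _ (fun _ _ => exchange_big _ _ _ _ _ _)) /=.
  rewrite exchange_big /=; apply: eq_bigr => j _.
  by rewrite -(pair_bigA _ (fun k l => X i j * Y k l * (M j k * (M i l)^*))).
rewrite /twirl !trE big_distrlr /=.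
apply: eq_bigr => p _; apply: eq_bigr => p' _.
rewrite /entry_monomial !big_cons !big_nil /=; ring.
Qed.

Lemma twirl_scalarl A' B B' M : scalar (fun A => twirl A A' B B' M).
Proof.
move=> c X Y; rewrite /twirl !mulmxDl -!scalemxAl [\tr (_ + _)]mxtraceD.
by rewrite [\tr (_ *: _)]mxtraceZ mulrDl -mulrA.
Qed.

Lemma twirl_scalarr A B B' M : scalar (fun A' => twirl A A' B B' M).
Proof.
move=> c X Y; rewrite /twirl !mulmxDl -!scalemxAl [\tr (_ + _)]mxtraceD.
by rewrite [\tr (_ *: _)]mxtraceZ mulrDr mulrCA.
Qed.

(** Conjugating both observables amounts to translating the argument, so left invariance of the Haar
    measure becomes the unitary invariance of the averaged form. *)
Lemma twirl_mull V A A' B B' M :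
  twirl (V ^t* *m A *m V) (V ^t* *m A' *m V) B B' M = twirl A A' B B' (V *m M).
Proof.
have trE X Y : \tr (V ^t* *m X *m V *m M *m Y *m M ^t*) =
    \tr (X *m (V *m M) *m Y *m (V *m M) ^t*).
  rewrite trmxCM -[in LHS]mulmxA -[in LHS]mulmxA -[in LHS]mulmxA -[in LHS]mulmxA.
  by rewrite mxtrace_mulC !mulmxA.
by rewrite /twirl; congr (_ * _); exact: trE.
Qed.

Lemma mxtrace_unitary_conj B M : M \is unitarymx -> \tr (M *m B *m M ^t*) = \tr B.
Proof. by move=> uM; rewrite mxtrace_mulC mulmxA unitarymx_mulCV// mul1mx. Qed.

(** With X = M B M^* and Y = M B' M^* the summand is X_ji Y_ij, so the sum is Tr(X Y), where the
    unitary cancels. *)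
Lemma twirl_sum_delta B B' M : M \is unitarymx ->
  \sum_i \sum_j twirl (delta_mx i j) (delta_mx j i) B B' M = \tr (B *m B').
Proof.
move=> uM; pose X := M *m B *m M ^t*; pose Y := M *m B' *m M ^t*.
have -> : \tr (B *m B') = \tr (X *m Y).
  by rewrite /X /Y !mulmxA mulmxKtV// -(mulmxA M) mxtrace_unitary_conj.
rewrite exchange_big; apply: eq_bigr => i _; rewrite mxE; apply: eq_bigr => j _.
by rewrite /twirl -!(mulmxA (delta_mx _ _)) !mxtrace_delta_mull.
Qed.

Lemma twirl1 B B' M : M \is unitarymx -> twirl 1%:M 1%:M B B' M = \tr B * \tr B'.
Proof.
by move=> uM; rewrite /twirl !mul1mx !mxtrace_unitary_conj.
Qed.

Lemma bmeas_twirl A A' B B' : bmeas unitary_set (twirl A A' B B').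
Proof.
by apply: bmeasM; apply: bmeas_mxtrace;
  do ![apply: mbmeasM; [|exact: mbmeas_cst]|apply: mbmeas_cst|apply: mbmeas_id
      |apply: mbmeas_trmxC|apply: mbmeasM].
Qed.

Lemma bmeas_entry_monomial s s' :
  bmeas unitary_set (fun M : cmx R n => entry_monomial s s' M).
Proof.
apply: bmeasM; apply: bmeas_prod => p; first exact: mbmeas_id.
exact/bmeas_conj/mbmeas_id.
Qed.

Lemma Cint_twirl_haar mu haar : mu unitary_set = 1%E -> is_haar haar ->
  (forall s s' : seq ('I_n * 'I_n), (size s <= 2)%N -> (size s' <= 2)%N ->
    ('E_mu[fun M => complex.Re (entry_monomial s s' M)] =
     'E_haar[fun M => complex.Re (entry_monomial s s' M)])%E /\
    ('E_mu[fun M => complex.Im (entry_monomial s s' M)] =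
     'E_haar[fun M => complex.Im (entry_monomial s s' M)])%E) ->
  forall A A' B B', Cint mu (twirl A A' B B') = Cint haar (twirl A A' B B').
Proof.
move=> mu1 [haar1 _] E A A' B B'.
have mU := @measurable_unitary_set R n.
rewrite (funext (twirlE A A' B B')).
have mm s s' c : bmeas unitary_set (fun M : cmx R n => c * entry_monomial s s' M).
  by apply: bmeasM; [exact: bmeas_cst|exact: bmeas_entry_monomial].
rewrite (Cint_sum mU mu1); last by move=> p; apply: bmeas_sum.
rewrite (Cint_sum mU haar1); last by move=> p; apply: bmeas_sum.
apply: eq_bigr => p _.
rewrite (Cint_sum mU mu1)// (Cint_sum mU haar1)//; apply: eq_bigr => p' _.
rewrite (CintZ mU mu1); last exact: bmeas_entry_monomial.
rewrite (CintZ mU haar1); last exact: bmeas_entry_monomial.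
congr (_ * _); rewrite /Cint; set s := [:: _; _]; set s' := [:: _; _].
have [] := E s s' isT isT; rewrite unlock => e1 e2.
by rewrite /Rintegral e1 e2.
Qed.

(** Invariance is assumed on sets; it passes to bounded functions by the change of variables for the
    pushforward under left multiplication. *)
Lemma Cint_haar_mull haar V (f : cmx R n -> R[i]) : is_haar haar ->
  V \is unitarymx -> bmeas unitary_set f ->
  Cint haar (fun M : cmx R n => f (V *m (M : 'M[R[i]]_n))) = Cint haar f.
Proof.
move=> [haar1 haarI] uV mf; have mU := @measurable_unitary_set R n.
pose L (M : cmx R n) : cmx R n := V *m (M : 'M[R[i]]_n).
have mL : measurable_fun setT L.
  by apply/measurable_cmxP; apply: mbmeasM; [exact: mbmeas_cst|exact: mbmeas_id0].
have mfL : bmeas unitary_set (fun M => f (L M)).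
  have [f1 f2 [c fc]] := mf; split.
  - exact: (measurableT_comp f1).
  - exact: (measurableT_comp f2).
  - exists c => M uM; have uLM : unitary_set (L M) := mul_unitarymx uV uM.
    exact: fc uLM.
have key (h : cmx R n -> R) : measurable_fun setT h ->
    haar.-integrable setT (EFin \o (h \o L)) ->
    \int[haar]_x h (L x) = \int[haar]_x h x.
  move=> mh ih; congr fine.
  have -> : (\int[haar]_x (h x)%:E = \int[pushforward haar L]_x (h x)%:E)%E.
    by apply: eq_measure_integral => E mE _; rewrite /= /pushforward haarI.
  rewrite (integral_pushforward mL)//; exact/measurable_EFinP.
have [f1 f2 _] := mf; rewrite /Cint; congr Complex; apply: key => //.
- exact: (bmeas_integrable_Re mU haar1 mfL).
- exact: (bmeas_integrable_Im mU haar1 mfL).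
Qed.

(** After passing from the design to the Haar measure, [invariant_bilinear_hermitian] applies to the
    averaged [twirl]. Its two calibrating values are integrals of functions that are constant on the
    unitary group, namely Tr B Tr B' and Tr(B B'), so no Haar integral has to be evaluated
    explicitly. *)
Lemma second_moment mu A B B' (i0 i1 : 'I_n) : i0 != i1 ->
  unitary_2design mu -> A \is hermsymmx ->
  let q := n%:R in
  (q ^+ 3 - q) * Cint mu (twirl A A B B') =
  (q * \tr (B *m B') - \tr B * \tr B') * \tr (A *m A) +
  (q * (\tr B * \tr B') - \tr (B *m B')) * \tr A ^+ 2.
Proof.
move=> i01 [mu1 [haar hH E]] hA q.
rewrite (Cint_twirl_haar mu1 hH E).
have [haar1 _] := hH; have mU := @measurable_unitary_set R n.
pose F X Y := Cint haar (twirl X Y B B').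
have Fl Y : scalar (F ^~ Y).
  move=> c X X'; rewrite /F -(CintZ mU haar1); last exact: bmeas_twirl.
  rewrite -(CintD mU haar1); last 2 first.
    by apply: bmeasM; [exact: bmeas_cst|exact: bmeas_twirl].
    exact: bmeas_twirl.
  by congr Cint; apply/funext => M; exact: twirl_scalarl.
have Fr X : scalar (F X).
  move=> c Y Y'; rewrite /F -(CintZ mU haar1); last exact: bmeas_twirl.
  rewrite -(CintD mU haar1); last 2 first.
    by apply: bmeasM; [exact: bmeas_cst|exact: bmeas_twirl].
    exact: bmeas_twirl.
  by congr Cint; apply/funext => M; exact: twirl_scalarr.
have Finv V X Y : V \is unitarymx ->
    F (V ^t* *m X *m V) (V ^t* *m Y *m V) = F X Y.
  move=> uV; rewrite /F -[RHS](Cint_haar_mull hH uV); last exact: bmeas_twirl.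
  by congr Cint; apply/funext => M; exact: twirl_mull.
have := invariant_bilinear_hermitian Fl Fr Finv i01 hA.
rewrite /= -/q -[F A A]/(Cint haar (twirl A A B B')) => ->.
have -> : F 1%:M 1%:M = \tr B * \tr B'.
  rewrite -[RHS](Cint_cst haar); apply: (eq_Cint mU haar1).
  - exact: bmeas_set0 (bmeas_twirl _ _ _ _).
  - exact: bmeas_cst.
  - by move=> M uM; rewrite twirl1.
have -> // : \sum_i \sum_j F (delta_mx i j) (delta_mx j i) = \tr (B *m B').
rewrite -[RHS](Cint_cst haar).
have sumE i : \sum_j F (delta_mx i j) (delta_mx j i) =
    Cint haar (fun M => \sum_j twirl (delta_mx i j) (delta_mx j i) B B' M).
  by rewrite (Cint_sum mU haar1)// => j; exact: bmeas_twirl.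
under eq_bigr do rewrite sumE.
rewrite -(Cint_sum mU haar1); last by move=> i; apply: bmeas_sum => j; exact: bmeas_twirl.
apply: (eq_Cint mU haar1).
- by apply: bmeas_sum => i; apply: bmeas_sum => j; exact: bmeas_set0 (bmeas_twirl _ _ _ _).
- exact: bmeas_cst.
- by move=> M uM; rewrite twirl_sum_delta.
Qed.

End SecondMoment.

(** * Integrating out an independent variable *)

Section Freezing.
Variables (R : realType) (d d' : measure_display) (T : measurableType d)
  (T' : measurableType d') (P : probability T R) (I : finType) (X : I -> T -> T').
Hypothesis mX : forall i, measurable_fun setT (X i).

Definition cylinders (J : {set I}) : set (set T) :=
  [set A | exists2 E : I -> set T', (forall i, i \in J -> measurable (E i)) &
     A = \bigcap_(i in [set` J]) (X i @^-1` E i)].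

(* T itself with a coarser sigma-algebra plays the role of the product space in
   which the X i, i \in J, take their values. *)
Definition sub_space (J : {set I}) := g_sigma_algebraType (cylinders J).

Variable J : {set I}.

Lemma cylinders_measurable : cylinders J `<=` measurable.
Proof.
move=> _ [E mE ->]; apply: fin_bigcap_measurable => [|i /= iJ].
  exact: finite_finset.
by rewrite -[X in measurable X]setTI; apply: mX => //; exact: mE.
Qed.

Lemma cylinders_setI : setI_closed (cylinders J).
Proof.
move=> _ _ [E mE ->] [F mF ->]; exists (fun i => E i `&` F i).
  by move=> i iJ; apply: measurableI; [exact: mE|exact: mF].
rewrite -bigcapI; apply: eq_bigcapr => i _; by rewrite preimage_setI.
Qed.

Lemma cylinders_setT : cylinders J setT.
Proof.
exists (fun=> setT) => //; apply/seteqP; split => // w _ i _ //.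
Qed.

Lemma measurable_sub_id : measurable_fun setT (id : T -> sub_space J).
Proof.
move=> _ A mA; rewrite setTI preimage_id.
exact: (smallest_sub (@sigma_algebra_measurable _ T) cylinders_measurable).
Qed.

Lemma measurable_sub_coord i : i \in J ->
  measurable_fun setT (X i : sub_space J -> T').
Proof.
move=> iJ _ B mB; rewrite setTI; apply: sub_sigma_algebra.
exists (fun k => if k == i then B else setT) => [k _|].
  by case: ifP.
apply/seteqP; split=> w /=.
  by move=> Bw k _ /=; case: eqP => // ->.
by move=> /(_ i iJ); rewrite eqxx.
Qed.

Hypothesis indep : mutually_independent P X.
Variables (i0 : I) (Y : {RV P >-> T'}).
Hypotheses (i0J : i0 \notin J) (YE : X i0 = Y).

(** As functions of [A], both sides are finite measures. They agree on the cylinders, which are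
    stable under intersection, and hence on the sigma-algebra that these generate. *)
Lemma indep_rect (A : set T) (B : set T') : <<s cylinders J >> A -> measurable B ->
  P (A `&` Y @^-1` B) = (P A * P (Y @^-1` B))%E.
Proof.
move=> sA mB.
have mYB : measurable (Y @^-1` B) by exact: measurable_funPTI.
have PYB : P (Y @^-1` B) \is a fin_num by exact: fin_num_measure.
have c0 : (0 <= fine (P (Y @^-1` B)))%R by rewrite fine_ge0// measure_ge0.
pose m1 := [the {measure set T -> \bar R} of mrestr P mYB].
pose m2 := [the {measure set T -> \bar R} of mscale (NngNum c0) P].
suff : m1 A = m2 A.
  by rewrite /m1 /m2 /= /mrestr /mscale /= fineK// muleC.
apply: (g_sigma_algebra_measure_unique (cylinders J) cylinders_measurable
  (fun=> setT)) sA.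
- by move=> _; exact: cylinders_setT.
- by rewrite bigcup_const//; exists 0%N.
- exact: cylinders_setI.
- move=> _ [E mE ->]; rewrite /m1 /m2 /= /mrestr /mscale /= fineK//.
  (* Independence is applied to [J] enlarged by [i0], with [B] as the event at [i0]; dividing the
     family again leaves the cylinder and the event of [Y]. *)
  pose E' i := if i == i0 then B else E i.
  have neq i : i \in J -> (i == i0) = false.
    by move=> iJ; apply/eqP => ii0; rewrite ii0 (negbTE i0J) in iJ.
  have := @indep (i0 |: J) E'; rewrite big_setU1//= /E' eqxx YE.
  have -> : \bigcap_(i in [set` (i0 |: J)%SET]) (X i @^-1` (if i == i0 then B else E i)) =
      (\bigcap_(i in [set` J]) (X i @^-1` E i)) `&` Y @^-1` B.
    apply/seteqP; split => w /=.
      move=> h; split.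
        by move=> i iJ; have := h i; rewrite /= !inE iJ orbT neq//; exact.
      by have := h i0; rewrite /= !inE eqxx YE; exact.
    move=> [h1 h2] i; rewrite /= !inE; have [->|_ /= iJ] := eqVneq i i0.
      by rewrite YE.
    exact: h1.
  move=> ->; last first.
    move=> i; rewrite !inE; have [//|_ /= iJ] := eqVneq i i0; exact: mE.
  rewrite (@indep J E)//; congr (_ * _)%E; apply: eq_bigr => i iJ.
  by rewrite neq.
- move=> k; rewrite /m1 /= /mrestr; apply: (le_lt_trans (_ : _ <= P setT)%E).
    by apply: le_measure; rewrite ?inE//; exact: measurableI.
  by rewrite probability_setT ltry.
Qed.

Let sub_id : {mfun T >-> sub_space J} := HB.pack (id : T -> sub_space J)
  (isMeasurableFun.Build _ _ T (sub_space J) id measurable_sub_id).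

Let graph (w : T) : sub_space J * T' := (w, Y w).

Let measurable_graph : measurable_fun setT graph.
Proof.
by apply: (measurable_fun_pair (f := id : T -> sub_space J)) => //; exact: measurable_sub_id.
Qed.

Variable f : sub_space J * T' -> \bar R.
Hypotheses (mf : measurable_fun setT f) (f0 : forall x, (0 <= f x)%E).

(** Measurability of [f] over [sub_space J] says that [f] sees the sample point only through the
    [X i] with i in [J]. By [indep_rect] the law of [graph] is then a product measure, and Tonelli
    integrates [Y] out with the other variables held fixed. *)
Lemma freezing :
  (\int[P]_w f ((w : sub_space J), Y w) =
   \int[P]_w \int[distribution P Y]_y f ((w : sub_space J), y))%E.
Proof.
pose Q := distribution P sub_id.
have E0 (h : sub_space J -> \bar R) : measurable_fun setT h -> (forall x, 0 <= h x)%E ->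
    (\int[P]_w h w = \int[Q]_w h w)%E.
  by move=> mh h0; rewrite (ge0_integral_pushforward measurable_sub_id).
pose m' : {measure set (sub_space J * T') -> \bar R} :=
  [the measure _ _ of distribution P
    (HB.pack graph
      (isMeasurableFun.Build _ _ _ _ _ measurable_graph) : {mfun T >-> _})].
transitivity (\int[m']_z f z)%E.
  by rewrite (ge0_integral_pushforward measurable_graph).
transitivity (\int[Q \x distribution P Y]_z f z)%E.
  apply: eq_measure_integral => A mA _; apply/esym.
  apply: (product_measure_unique (m' := m')) => // B1 B2 mB1 mB2.
  exact: indep_rect.
rewrite fubini_tonelli1// -E0//.
  exact: measurable_fun_fubini_tonelli_F.
by move=> x; apply: integral_ge0.
Qed.

Lemma measurable_freezing :
  measurable_fun setT (fun w : T => \int[distribution P Y]_y f ((w : sub_space J), y))%E.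
Proof.
have := measurable_fun_fubini_tonelli_F (m2 := distribution P Y) f mf f0.
move=> mF; exact: (measurableT_comp mF measurable_sub_id).
Qed.

End Freezing.

(** * Derivatives of the circuit *)

Section ReflectionExponential.
Variables (R : realType) (n : nat) (H : 'M[R[i]]_n).
Hypothesis HH : H *m H = 1%:M.

(** Since H^2 = 1, the even terms of the series are multiples of 1 and the odd ones multiples of H,
    with the coefficients of the cosine and sine series. *)
Lemma exp_reflection_coef (x : R) (l : nat) :
  (l`!%:R^-1 : R[i]) *: ((0 -i* x)%C *: H) ^+ l =
  (cos_coeff x l)%:C%C *: 1%:M + (0 -i* sin_coeff x l)%C *: H.
Proof.
have H2 : H ^+ 2 = 1 by rewrite expr2 -mulmxE HH idmxE.
have c2 : (0 -i* x)%C ^+ 2 = (- x ^+ 2)%:C%C.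
  by rewrite expr2; apply/eqP; rewrite eq_complex /=; apply/andP; split; apply/eqP; ring.
have fE : (l`!%:R^-1 : R[i]) = (l`!%:R^-1 : R)%:C%C.
  by rewrite rmorphV ?unitfE ?pnatr_eq0 -?lt0n ?fact_gt0// rmorph_nat.
have -> : ((0 -i* x)%C *: H) ^+ l = (0 -i* x)%C ^+ l *: H ^+ l.
  elim: l {fE} => [|l IH]; first by rewrite !expr0 scale1r.
  by rewrite !exprS -!mulmxE IH -scalemxAl -scalemxAr scalerA.
rewrite scalerA {}fE /cos_coeff /sin_coeff.
case ol : (odd l).
  have {ol} [k ->] : exists k, l = k.*2.+1.
    by exists l./2; rewrite -[LHS]odd_double_half ol add1n.
  rewrite /= odd_double /= doubleK !mul1r !mul0r scale0r add0r -mul2n.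
  rewrite !exprS !exprM H2 expr1n c2 -rmorphXn /= mulr1; congr (_ *: _).
  rewrite [(- x ^+ 2) ^+ k]exprNn; apply/eqP; rewrite eq_complex /=.
  by apply/andP; split; apply/eqP; ring.
have {ol} [k ->] : exists k, l = k.*2.
  by exists l./2; rewrite -[LHS]odd_double_half ol.
rewrite /= odd_double /= doubleK !mul1r !mul0r oppr0 scale0r addr0 -mul2n.
rewrite !exprM H2 expr1n c2 -rmorphXn -rmorphM /= idmxE; congr (_%:C%C *: _).
rewrite [(- x ^+ 2) ^+ k]exprNn -exprnP; ring.
Qed.

Lemma mexp_reflection (x : R) :
  mexp ((0 -i* x)%C *: H) = (cos x)%:C%C *: 1%:M + (0 -i* sin x)%C *: H.
Proof.
have sE k : mexp_sum ((0 -i* x)%C *: H) k =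
    (series (cos_coeff x) k)%:C%C *: 1%:M + (0 -i* series (sin_coeff x) k)%C *: H.
  rewrite /mexp_sum; under eq_bigr do rewrite exp_reflection_coef.
  rewrite big_split /= -!scaler_suml /series /= !big_mkord; congr (_ *: _ + _ *: _).
    by rewrite rmorph_sum.
  elim/big_ind2 : _ => //= [|a b c e -> ->].
    by rewrite oppr0.
  by apply/eqP; rewrite eq_complex /= addr0 opprD !eqxx.
have cc := @is_cvg_series_cos_coeff R x; have cs := @is_cvg_series_sin_coeff R x.
have cvc : series (cos_coeff x) @ \oo --> cos x by rewrite unlock.
have cvs : series (sin_coeff x) @ \oo --> sin x by rewrite unlock.
apply/matrixP => i j; rewrite mxE; apply/eqP; rewrite eq_complex; apply/andP.
split; apply/eqP.
- rewrite [LHS]/=; apply/cvg_lim => //.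
  (* Each entry of a partial sum is a fixed linear combination of the partial sums of cosine and
     sine, so the limit can be taken in these two real series. *)
  rewrite (_ : (fun k => _) = (fun k => series (cos_coeff x) k * (i == j)%:R
      + series (sin_coeff x) k * complex.Im (H i j))); last first.
    apply/funext => k; rewrite sE !mxE; case: (H i j) (i == j) => a b [] /=; ring.
  rewrite (_ : complex.Re _ = cos x * (i == j)%:R + sin x * complex.Im (H i j)).
    by apply: cvgD; apply: cvgM => //; exact: cvg_cst.
  rewrite !mxE; case: (H i j) (i == j) => a b [] /=; ring.
- rewrite [LHS]/=; apply/cvg_lim => //.
  rewrite (_ : (fun k => _) =
      (fun k => - (series (sin_coeff x) k * complex.Re (H i j)))); last first.
    apply/funext => k; rewrite sE !mxE; case: (H i j) (i == j) => a b [] /=; ring.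
  rewrite (_ : complex.Im _ = - (sin x * complex.Re (H i j))).
    by apply: cvgN; apply: cvgM => //; exact: cvg_cst.
  rewrite !mxE; case: (H i j) (i == j) => a b [] /=; ring.
Qed.

Lemma mexp_reflection_unitary (x : R) : H \is hermsymmx ->
  mexp ((0 -i* x)%C *: H) \is unitarymx.
Proof.
move=> /hermsymmxP hH; apply/unitarymxP; rewrite mexp_reflection.
set c := (cos x)%:C%C; set s := (0 -i* sin x)%C.
have -> : (c *: 1%:M + s *: H) ^t* = c *: 1%:M - s *: H.
  rewrite trmxCD !trmxCZ trmx1 map_mx1 hH -scaleNr.
  congr (_ *: _ + _ *: _); rewrite /c /s /=; apply/eqP; rewrite eq_complex /= ?oppr0 ?opprK ?eqxx//.
rewrite mulmxDl !mulmxBr -!scalemxAl -!scalemxAr !mul1mx mulmx1 HH !scalerA.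
rewrite (mulrC s c) addrA subrK -scalerBl.
have -> : c * c - s * s = 1.
  rewrite /c /s; apply/eqP; rewrite eq_complex /=; apply/andP; split; apply/eqP.
    by rewrite -(cos2Dsin2 x); ring.
  ring.
by rewrite scale1r.
Qed.

End ReflectionExponential.

(** * Directional derivatives of complex and matrix valued functions *)

Section ComplexDerivative.
Variables (R : realType) (V : normedModType R) (x v : V).
Implicit Types (f g : V -> R[i]).

Definition is_cderive f (df : R[i]) : Prop :=
  is_derive x v (fun t => complex.Re (f t)) (complex.Re df) /\
  is_derive x v (fun t => complex.Im (f t)) (complex.Im df).

Lemma is_cderive_unique f df df' : is_cderive f df -> is_cderive f df' -> df = df'.
Proof.
move=> [/@derive_val h1 /@derive_val h2] [/@derive_val h3 /@derive_val h4].
by apply/eqP; rewrite eq_complex -h1 -h2 -h3 -h4 !eqxx.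
Qed.

Lemma is_cderive_cst c : is_cderive (fun=> c) 0.
Proof. by split; exact: is_derive_cst. Qed.

Lemma is_cderiveD f g df dg : is_cderive f df -> is_cderive g dg ->
  is_cderive (fun t => f t + g t) (df + dg).
Proof.
move=> [f1 f2] [g1 g2]; split.
- have := is_deriveD f1 g1; rewrite -raddfD; congr is_derive.
  by apply/funext => t; rewrite raddfD.
- have := is_deriveD f2 g2; rewrite -raddfD; congr is_derive.
  by apply/funext => t; rewrite raddfD.
Qed.

Lemma is_cderiveM f g df dg : is_cderive f df -> is_cderive g dg ->
  is_cderive (fun t => f t * g t) (df * g x + f x * dg).
Proof.
move=> [f1 f2] [g1 g2]; split.
- have := is_deriveB (is_deriveM f1 g1) (is_deriveM f2 g2).
  congr (is_derive _ _ _ _).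
    by apply/funext => t; rewrite !fctE; case: (f t) (g t) => [? ?] [].
  rewrite /GRing.scale /=.
  by case: (f x) (g x) df dg {f1 f2 g1 g2} => [a b] [a' b'] [c d] [c' d'] /=; ring.
- have := is_deriveD (is_deriveM f1 g2) (is_deriveM f2 g1).
  congr (is_derive _ _ _ _).
    by apply/funext => t; rewrite !fctE; case: (f t) (g t) => [? ?] [].
  rewrite /GRing.scale /=.
  by case: (f x) (g x) df dg {f1 f2 g1 g2} => [a b] [a' b'] [c d] [c' d'] /=; ring.
Qed.

Lemma is_cderive_conj f df : is_cderive f df -> is_cderive (fun t => (f t)^*) df^*.
Proof.
move=> [f1 f2]; split.
- move: f1; congr (is_derive _ _ _ _); last by case: df {f2}.
  by apply/funext => t; case: (f t).
- have := is_deriveN f2; congr (is_derive _ _ _ _); last by case: df {f1 f2}.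
  by apply/funext => t; rewrite !fctE; case: (f t).
Qed.

Lemma is_cderive_sum (I : finType) (f : I -> V -> R[i]) (df : I -> R[i]) :
  (forall i, is_cderive (f i) (df i)) ->
  is_cderive (fun t => \sum_i f i t) (\sum_i df i).
Proof.
move=> mf; elim: (index_enum I) => [|i r ih].
  by under eq_fun do rewrite big_nil; rewrite big_nil; exact: is_cderive_cst.
by under eq_fun do rewrite big_cons; rewrite big_cons; exact: is_cderiveD.
Qed.

Lemma is_cderive_real (h : V -> R) (dh : R) : is_derive x v h dh ->
  is_cderive (fun t => (h t)%:C%C) dh%:C%C.
Proof. by move=> ih; split => //; exact: is_derive_cst. Qed.

Variable n : nat.
Implicit Types (A B : V -> 'M[R[i]]_n).

Definition is_mxderive A (dA : 'M[R[i]]_n) :=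
  forall i j, is_cderive (fun t => A t i j) (dA i j).

Lemma is_mxderive_unique A dA dA' : is_mxderive A dA -> is_mxderive A dA' -> dA = dA'.
Proof. by move=> h h'; apply/matrixP => i j; apply: is_cderive_unique (h i j) (h' i j). Qed.

Lemma is_mxderive_cst (A : 'M[R[i]]_n) : is_mxderive (fun=> A) 0.
Proof. by move=> i j; rewrite mxE; exact: is_cderive_cst. Qed.

Lemma is_mxderiveD A B dA dB : is_mxderive A dA -> is_mxderive B dB ->
  is_mxderive (fun t => A t + B t) (dA + dB).
Proof.
move=> hA hB i j; rewrite mxE; under eq_fun do rewrite mxE; exact: is_cderiveD.
Qed.

Lemma is_mxderiveZ (c : V -> R[i]) dc B dB : is_cderive c dc -> is_mxderive B dB ->
  is_mxderive (fun t => c t *: B t) (dc *: B x + c x *: dB).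
Proof.
move=> hA hB i j; rewrite !mxE; under eq_fun do rewrite mxE; exact: is_cderiveM.
Qed.

Lemma is_mxderiveM A B dA dB : is_mxderive A dA -> is_mxderive B dB ->
  is_mxderive (fun t => A t *m B t) (dA *m B x + A x *m dB).
Proof.
move=> hA hB i j; rewrite !mxE -big_split /=; under eq_fun do rewrite mxE.
by apply: is_cderive_sum => k; exact: is_cderiveM.
Qed.

Lemma is_mxderive_trmxC A dA : is_mxderive A dA ->
  is_mxderive (fun t => (A t) ^t*) (dA ^t*).
Proof.
move=> hA i j; rewrite !mxE; under eq_fun do rewrite !mxE; exact: is_cderive_conj.
Qed.

Lemma is_cderive_mxtrace A dA : is_mxderive A dA ->
  is_cderive (fun t => \tr (A t)) (\tr dA).
Proof. by move=> hA; apply: is_cderive_sum. Qed.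

(** Existence of the derivative of the circuit is enough: the properties used later come from
    differentiating identities satisfied by the evolved observable, not from a product formula. *)
Lemma is_mxderive_prod (I : Type) (r : seq I) (A : I -> V -> 'M[R[i]]_n) :
  (forall i, exists dA, is_mxderive (A i) dA) ->
  exists dA, is_mxderive (fun t => \prod_(i <- r) A i t) dA.
Proof.
move=> hA; elim: r => [|i r [dP hP]].
  exists 0; under eq_fun do rewrite big_nil; exact: is_mxderive_cst.
have [dA hi] := hA i; eexists; under eq_fun do rewrite big_cons.
exact: is_mxderiveM hi hP.
Qed.

End ComplexDerivative.

(** * The evolved observable and its derivatives *)

Section QuantumNeuralNetwork.
Variables (R : realType) (n D : nat) (H W : 'I_D -> 'M[R[i]]_n)
  (theta0 : 'rV[R]_D) (Obs : 'M[R[i]]_n).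
Hypotheses (H_herm : forall l, H l \is hermsymmx)
  (H_unitary : forall l, H l \is unitarymx)
  (W_unitary : forall l, W l \is unitarymx)
  (Obs_herm : Obs \is hermsymmx) (Obs_tr0 : \tr Obs = 0).

Let HH l : H l *m H l = 1%:M.
Proof.
by rewrite -{2}(hermsymmxP _ (H_herm l)); apply/unitarymxP.
Qed.

Lemma qnn_unitary theta : qnn H W theta \is unitarymx.
Proof.
rewrite /qnn; elim/big_ind : _ => [|A B uA uB|l _].
- by apply/unitarymxP; rewrite -idmxE trmx1 map_mx1 mulmx1.
- by rewrite -mulmxE; exact: mul_unitarymx.
- by apply: mul_unitarymx => //; exact: mexp_reflection_unitary.
Qed.

Lemma qnn_derivable (v : 'rV[R]_D) : exists dV, is_mxderive theta0 v (qnn H W) dV.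
Proof.
apply: is_mxderive_prod => l.
have diff (g : R -> R) : (forall y, derivable g y 1) ->
    derivable (fun t : 'rV[R]_D => g (t 0 (rev_ord l) / 2)) theta0 v.
  move=> dg; apply: diff_derivable.
  have dh : differentiable (fun t : 'rV[R]_D => t 0 (rev_ord l) / 2) theta0.
    by apply: differentiableM => //; exact: differentiable_coord.
  by apply: (differentiable_comp dh); exact/derivable1_diffP.
have [ds hs] : exists ds, is_cderive theta0 v
    (fun t : 'rV[R]_D => (0 -i* sin (t 0 (rev_ord l) / 2))%C) ds.
  exists (0 -i* 'D_v (fun t : 'rV[R]_D => sin (t 0%R (rev_ord l) / 2)) theta0)%C.
  split; first exact: is_derive_cst.
  exact/is_deriveN/derivableP/diff/derivable_sin.
eexists; apply: is_mxderiveM; last exact: is_mxderive_cst.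
under eq_fun do rewrite mexp_reflection//.
apply: is_mxderiveD; apply: is_mxderiveZ; try exact: is_mxderive_cst.
- exact/is_cderive_real/derivableP/diff/derivable_cos.
- exact: hs.
Qed.

Definition heisenberg theta : 'M[R[i]]_n := (qnn H W theta) ^t* *m Obs *m qnn H W theta.

Lemma heisenberg_herm theta : heisenberg theta \is hermsymmx.
Proof.
apply/hermsymmxP; rewrite /heisenberg !trmxCM trmxCK.
by rewrite (hermsymmxP _ Obs_herm) mulmxA.
Qed.

Lemma heisenberg_tr theta : \tr (heisenberg theta) = 0.
Proof.
rewrite /heisenberg mxtrace_mulC mulmxA.
by rewrite (unitarymxP (qnn_unitary theta)) mul1mx.
Qed.

Lemma heisenberg_tr2 theta :
  \tr (heisenberg theta *m heisenberg theta) = \tr (Obs *m Obs).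
Proof.
rewrite /heisenberg !mulmxA mulmxtVK ?qnn_unitary//.
by rewrite mxtrace_mulC !mulmxA (unitarymxP (qnn_unitary theta)) mul1mx.
Qed.

Lemma predictionE theta rho :
  prediction Obs H W theta rho = complex.Re (\tr (heisenberg theta *m rho)).
Proof. by []. Qed.

(* As \tr(heisenberg^2) is constant, heisenberg is orthogonal to its derivatives. *)
Lemma heisenberg_derivative (l : 'I_D) : exists G : 'M[R[i]]_n,
  [/\ G \is hermsymmx, \tr G = 0, \tr (heisenberg theta0 *m G) = 0 &
    forall rho, dprediction Obs H W theta0 l rho = complex.Re (\tr (G *m rho))].
Proof.
pose v : 'rV[R]_D := delta_mx 0 l; have [dV hV] := qnn_derivable v.
have [G hG] : exists G, is_mxderive theta0 v heisenberg G.
  eexists; apply: (is_mxderiveM _ hV); apply: is_mxderiveM; last exact: is_mxderive_cst.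
  exact: (is_mxderive_trmxC hV).
exists G; split.
- apply/hermsymmxP; apply: (is_mxderive_unique _ hG).
  have := is_mxderive_trmxC hG; congr is_mxderive; apply/funext => t.
  exact/hermsymmxP/heisenberg_herm.
- have h := is_cderive_mxtrace hG.
  apply: is_cderive_unique h _; under eq_fun do rewrite heisenberg_tr.
  exact: is_cderive_cst.
- have h := is_cderive_mxtrace (is_mxderiveM hG hG).
  have {}h : is_cderive theta0 v (fun=> \tr (Obs *m Obs))
      (\tr (G *m heisenberg theta0 + heisenberg theta0 *m G)).
    by move: h; congr (is_cderive _ _ _ _); apply/funext => t; exact: heisenberg_tr2.
  have /eqP := is_cderive_unique h (is_cderive_cst _ _ _); rewrite mxtraceD mxtrace_mulC -mulr2n.
  by rewrite mulrn_eq0 /= => /eqP.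
- move=> rho; have [h _] := is_cderive_mxtrace (is_mxderiveM hG (is_mxderive_cst theta0 v rho)).
  by rewrite /dprediction (derive_val (is_derive := h)) mulmx0 addr0.
Qed.

End QuantumNeuralNetwork.

(** * Averages over states and targets *)

Section DesignMoments.
Variables (R : realType) (N : nat).
Hypothesis N_gt0 : (0 < N)%N.
Local Notation q := (2 ^ N)%N.
Implicit Types (A B Z : 'M[R[i]]_q).

Lemma ket1_subproof : (1 < q)%N.
Proof. by rewrite -{1}(expn0 2) ltn_exp2l. Qed.

Let ket1 : 'I_q := Ordinal ket1_subproof.

Let ket01 : ket0 N != ket1.
Proof. by []. Qed.

Lemma dim_gt1 : 1 < q%:R :> R.
Proof. by rewrite ltr1n ket1_subproof. Qed.

Lemma dimC_neq0 : [/\ q%:R != 0 :> R[i], q%:R + 1 != 0 :> R[i] & q%:R - 1 != 0 :> R[i]].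
Proof.
have q1 := ket1_subproof; split; rewrite ?natr1 ?pnatr_eq0//.
  by rewrite -lt0n ltnW.
by rewrite subr_eq0 pnatr_eq1 gtn_eqF.
Qed.

Lemma Re_mul_real (z : R[i]) (x : R) : complex.Re (z * x%:C%C) = complex.Re z * x.
Proof. by case: z => a b /=; ring. Qed.

Lemma second_moment_div (mu : probability (cmx R q) R) A B B' :
  unitary_2design mu -> A \is hermsymmx ->
  Cint mu (twirl A A B B') =
  ((q%:R * \tr (B *m B') - \tr B * \tr B') * \tr (A *m A) +
   (q%:R * (\tr B * \tr B') - \tr (B *m B')) * \tr A ^+ 2) / (q%:R ^+ 3 - q%:R).
Proof.
move=> mu2 hA; have [q0 q1 q2] := dimC_neq0.
rewrite -(second_moment B B' ket01 mu2 hA) mulrC mulKf//.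
rewrite (_ : _ - _ = q%:R * (q%:R + 1) * (q%:R - 1)); last by ring.
by rewrite !mulf_neq0.
Qed.

Lemma state_of_herm (W : 'M[R[i]]_q) : state_of W \is hermsymmx.
Proof.
apply/hermsymmxP; rewrite /state_of !trmxCM trmxCK mulmxA.
by rewrite trmx_delta map_delta_mx.
Qed.

Lemma mbmeas_state_of (d : measure_display) (S : measurableType d) (D : set S)
    (f : S -> 'M[R[i]]_q) :
  mbmeas D f -> mbmeas D (fun x => state_of (f x)).
Proof.
move=> mf; apply: mbmeasM; last exact: mbmeas_trmxC.
by apply: mbmeasM => //; exact: mbmeas_cst.
Qed.

Lemma sqr_Re_hermitian A B : A \is hermsymmx -> B \is hermsymmx ->
  complex.Re (\tr (A *m B)) ^+ 2 = complex.Re (\tr (A *m B) * \tr (A *m B)).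
Proof.
move=> hA hB; have := mxtrace_hermitian_mul hA hB.
case: (\tr _) => a b /= [] /eqP.
by rewrite -subr_eq0 -opprD oppr_eq0 -mulr2n mulrn_eq0 /= => /eqP ->; rewrite expr2 mulr0 subr0.
Qed.

(** The squared expectation is a [twirl] with B = B' the projector on the reference state. Both
    coefficients of the second moment are then q - 1, and q^3 - q = q (q + 1) (q - 1) leaves the
    factor 1 / (q (q + 1)). *)
Lemma state_moment (nu : probability (cmx R q) R) Z : state_2design nu ->
  Z \is hermsymmx ->
  (\int[nu]_x ((complex.Re (\tr (Z *m (x : 'M[R[i]]_q))) ^+ 2)%:E) =
   (complex.Re (\tr (Z *m Z) + \tr Z ^+ 2) / (q%:R * (q%:R + 1)))%:E)%E.
Proof.
move=> [mu mu2 nuE] hZ.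
pose st (x : cmx R q) : cmx R q := state_of (x : 'M[R[i]]_q).
have mst : measurable_fun setT st.
  by apply/measurable_cmxP; apply: mbmeas_state_of; exact: mbmeas_id0.
pose f (x : cmx R q) := ((complex.Re (\tr (Z *m (x : 'M[R[i]]_q))) ^+ 2)%:E)%E.
have mf : measurable_fun setT f.
  have [h _ _] : bmeas set0 (fun x : cmx R q => \tr (Z *m (x : 'M[R[i]]_q))).
    apply: bmeas_mxtrace; apply: mbmeasM; first exact: mbmeas_cst.
    exact: mbmeas_id0.
  by apply/measurable_EFinP; apply: measurable_funX.
have -> : (\int[nu]_x f x = \int[pushforward mu st]_x f x)%E.
  by apply: eq_measure_integral => E mE _; exact: nuE.
rewrite (ge0_integral_pushforward mst)//; last first.
  by move=> x _; rewrite lee_fin sqr_ge0.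
pose E00 : 'M[R[i]]_q := delta_mx (ket0 N) (ket0 N).
rewrite preimage_setT (_ : f \o st = fun x => (complex.Re (twirl Z Z E00 E00 x))%:E); last first.
  apply/funext => x; rewrite /f /=; congr EFin.
  by rewrite sqr_Re_hermitian ?state_of_herm// /twirl /st /state_of !mulmxA.
have [mu1 _] := mu2.
rewrite (Re_Cint (@measurable_unitary_set R q) mu1); last exact: bmeas_twirl.
congr EFin; rewrite second_moment_div//.
have trE : \tr E00 = 1.
  have := mxtrace_delta_mul R[i] (ket0 N) (ket0 N) (ket0 N) (ket0 N).
  by rewrite mul_delta_mx !eqxx.
rewrite mul_delta_mx trE !mulr1.
have [q0 q1 q2] := dimC_neq0.
rewrite [X in complex.Re X](_ : _ =
    (\tr (Z *m Z) + \tr Z ^+ 2) * ((q%:R * (q%:R + 1))^-1 : R)%:C%C).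
  by rewrite Re_mul_real.
rewrite fmorphV rmorphM rmorphD rmorph1 rmorph_nat; field.
by rewrite q0 q1 /=; rewrite (_ : _ - _ = q%:R * (q%:R + 1) * (q%:R - 1)) ?mulf_neq0//; ring.
Qed.

End DesignMoments.

Section HermitianPart.
Variables (R : realType) (n : nat).
Implicit Types (A B : 'M[R[i]]_n).

(** The random matrices [rho i] are states only almost surely. Passing to the Hermitian part turns
    the real part of Tr(A B), for Hermitian A and arbitrary B, into a genuine trace, so the complex
    moment formulas apply at every sample point. *)
Definition herm_part A : 'M[R[i]]_n := 2^-1 *: (A + A ^t*).

Lemma herm_part_herm A : herm_part A \is hermsymmx.
Proof.
apply/hermsymmxP; rewrite /herm_part trmxCZ trmxCD trmxCK addrC.
by rewrite fmorphV rmorph_nat.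
Qed.

Lemma Re_mxtrace_herm A B : A \is hermsymmx ->
  (complex.Re (\tr (A *m B)))%:C%C = \tr (A *m herm_part B).
Proof.
move=> /hermsymmxP hA; rewrite /herm_part -scalemxAr mxtraceZ mulmxDr mxtraceD.
have -> : \tr (A *m B ^t*) = (\tr (A *m B))^*.
  by rewrite -{1}hA -trmxCM trace_map_mx mxtrace_tr mxtrace_mulC.
by rewrite ReJ_add mulrC.
Qed.

End HermitianPart.

Lemma mxtrace_sqrB3 (C : comNzRingType) n (A B D : 'M[C]_n) :
  \tr ((A - B - D) *m (A - B - D)) = \tr (A *m A) + \tr (B *m B) - 2 * \tr (A *m B)
    - 2 * \tr (A *m D) + 2 * \tr (B *m D) + \tr (D *m D).
Proof.
rewrite !mulmxBl !mulmxBr !raddfB /=.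
rewrite (mxtrace_mulC B A) (mxtrace_mulC D A) (mxtrace_mulC D B); ring.
Qed.

Section HermsymmxClosure.
Variables (C : numClosedFieldType) (n : nat).
Implicit Types (A B : 'M[C]_n).

Lemma hermsymmxB A B : A \is hermsymmx -> B \is hermsymmx -> A - B \is hermsymmx.
Proof.
move=> /hermsymmxP hA /hermsymmxP hB; apply/hermsymmxP.
by rewrite -scaleN1r trmxCD trmxCZ hA hB rmorphN1.
Qed.

Lemma hermsymmxZ c A : c^* = c -> A \is hermsymmx -> c *: A \is hermsymmx.
Proof.
by move=> hc /hermsymmxP hA; apply/hermsymmxP; rewrite trmxCZ hA hc.
Qed.

Lemma hermsymmx_sum (I : Type) (r : seq I) (A : I -> 'M[C]_n) :
  (forall i, A i \is hermsymmx) -> \sum_(i <- r) A i \is hermsymmx.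
Proof.
move=> hA; apply/hermsymmxP; elim: r => [|i r IH].
  by rewrite big_nil trmx0 map_mx0.
by rewrite big_cons trmxCD IH (hermsymmxP _ (hA i)).
Qed.

Lemma hermsymmx_conj A (V : 'M[C]_n) : A \is hermsymmx -> V ^t* *m A *m V \is hermsymmx.
Proof.
by move=> /hermsymmxP hA; apply/hermsymmxP; rewrite !trmxCM trmxCK hA mulmxA.
Qed.

End HermsymmxClosure.

(** * The average over the target unitary *)

Section TargetMoment.
Variables (R : realType) (N : nat).
Hypothesis N_gt0 : (0 < N)%N.
Local Notation q := (2 ^ N)%N.
Variables (mu : probability (cmx R q) R) (mu2 : unitary_2design mu).
Variables (Obs : 'M[R[i]]_q).
Hypotheses (Obs_herm : Obs \is hermsymmx) (Obs_tr0 : \tr Obs = 0).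

Let mU := @measurable_unitary_set R q.
Let mu1 : mu unitary_set = 1%E := mu2.1.

(** For a state [A] this is its label before the real part is taken, which keeps it complex linear
    in [A]. *)
Definition target_corr (A : 'M[R[i]]_q) (u : cmx R q) : R[i] :=
  \tr (Obs *m (u : 'M[R[i]]_q) *m A *m (u : 'M[R[i]]_q) ^t*).

Lemma bmeas_target_corr A : bmeas unitary_set (target_corr A).
Proof.
apply: bmeas_mxtrace; apply: mbmeasM; last exact/mbmeas_trmxC/mbmeas_id.
apply: mbmeasM; last exact: mbmeas_cst.
by apply: mbmeasM; [exact: mbmeas_cst|exact: mbmeas_id].
Qed.

(* Polarizing the second moment with the observable Obs + 1 and B' = 1. *)
Lemma target_first_moment A : Cint mu (target_corr A) = 0.
Proof.
have [q0 q1 q2] := dimC_neq0 R N_gt0.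
have h1 : Obs + 1%:M \is hermsymmx.
  apply/hermsymmxP; rewrite trmxCD trmx1 map_mx1.
  by rewrite (hermsymmxP _ Obs_herm).
have := second_moment_div N_gt0 A 1%:M mu2 h1.
rewrite mulmx1 mxtrace1 mxtraceD Obs_tr0 mxtrace1 add0r.
rewrite (mulrC (\tr A)) subrr mul0r add0r => e.
have : Cint mu (twirl (Obs + 1%:M) (Obs + 1%:M) A 1%:M) =
    q%:R * (Cint mu (target_corr A) + \tr A).
  rewrite -{1}(Cint_cst mu (\tr A)) -(CintD mU mu1); last 2 first.
  - exact: bmeas_target_corr.
  - exact: bmeas_cst.
  rewrite -(CintZ mU mu1); last first.
    by apply: bmeasD; [exact: bmeas_target_corr|exact: bmeas_cst].
  apply: (eq_Cint mU mu1).
  - exact: bmeas_set0 (bmeas_twirl _ _ _ _).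
  - apply: bmeasM; first exact: bmeas_cst.
    by apply: bmeasD; [apply: bmeas_set0 (bmeas_target_corr _)|exact: bmeas_cst].
  - move=> u uu; rewrite /twirl mulmx1 !mulmxDl !mul1mx !mxtraceD.
    by rewrite mxtrace_unitary_conj// mulmxtVK// (unitarymxP uu) Obs_tr0 mxtrace1 add0r mulrC.
rewrite {}e => /esym e; apply: (mulfI q0); apply: (addIr (q%:R * \tr A)).
rewrite -mulrDr e; field.
by rewrite (_ : _ - _ = q%:R * (q%:R + 1) * (q%:R - 1)) ?mulf_neq0//; ring.
Qed.

(** Tracelessness of [Obs] and of [B] leaves only the term in Tr(A B). The asymmetry is deliberate:
    [A] will be a training state, of trace 1, and [B] a traceless correction operator. *)
Lemma target_second_moment A B : \tr B = 0 ->
  Cint mu (fun u => target_corr A u * target_corr B u) =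
  \tr (Obs *m Obs) / (q%:R ^+ 2 - 1) * \tr (A *m B).
Proof.
move=> B0; have [q0 q1 q2] := dimC_neq0 R N_gt0.
have := second_moment_div N_gt0 A B mu2 Obs_herm.
rewrite B0 Obs_tr0 !mulr0 subr0 expr0n /= mulr0 addr0 => e.
rewrite -[LHS]/(Cint mu (twirl Obs Obs A B)) {}e; field.
have -> : q%:R ^+ 2 - 1 = (q%:R - 1) * (q%:R + 1) :> R[i] by ring.
rewrite (_ : q%:R ^+ 3 - _ = q%:R * (q%:R + 1) * (q%:R - 1)) ?mulf_neq0//; ring.
Qed.

Variables (I : finType) (M : 'M[R[i]]_q) (sigma Lam : I -> 'M[R[i]]_q).
Hypotheses (M_herm : M \is hermsymmx) (M_tr0 : \tr M = 0)
  (M_tr2 : \tr (M *m M) = \tr (Obs *m Obs)).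
Hypotheses (Lam_herm : forall a, Lam a \is hermsymmx) (Lam_tr0 : forall a, \tr (Lam a) = 0)
  (Lam_M : forall a, \tr (M *m Lam a) = 0).

(* the complexified initial residual of the training state sigma a *)
Definition cresidual (u : cmx R q) (a : I) : R[i] :=
  \tr (M *m herm_part (sigma a)) - target_corr (herm_part (sigma a)) u.

Definition correction (u : cmx R q) : 'M[R[i]]_q := \sum_a cresidual u a *: Lam a.

(* the operator whose expectation in a test state is the final test residual *)
Definition error_op (u : cmx R q) : 'M[R[i]]_q :=
  M - (u : 'M[R[i]]_q) ^t* *m Obs *m (u : 'M[R[i]]_q) - correction u.

Lemma target_corr_cyc A (u : cmx R q) :
  target_corr A u = \tr ((u : 'M[R[i]]_q) ^t* *m Obs *m (u : 'M[R[i]]_q) *m A).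
Proof. by rewrite /target_corr mxtrace_mulC !mulmxA. Qed.

Lemma cresidual_real u a : (cresidual u a)^* = cresidual u a.
Proof.
rewrite /cresidual rmorphB /= target_corr_cyc.
have hX := hermsymmx_conj (u : 'M[R[i]]_q) Obs_herm.
have hs := herm_part_herm (sigma a).
by rewrite (mxtrace_hermitian_mul M_herm hs) (mxtrace_hermitian_mul hX hs).
Qed.

Lemma correction_herm u : correction u \is hermsymmx.
Proof. apply: hermsymmx_sum => a; apply: hermsymmxZ; [exact: cresidual_real|exact: Lam_herm]. Qed.

Lemma error_op_herm u : error_op u \is hermsymmx.
Proof.
apply: hermsymmxB; last exact: correction_herm.
by apply: hermsymmxB; [exact: M_herm|exact: (hermsymmx_conj _ Obs_herm)].
Qed.

Lemma bmeas_cresidual a : bmeas unitary_set (cresidual ^~ a).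
Proof. by apply: bmeasB; [exact: bmeas_cst|exact: bmeas_target_corr]. Qed.

Lemma mbmeas_correction : mbmeas unitary_set correction.
Proof.
apply: mbmeas_sum => a; apply: mbmeasZ; first exact: bmeas_cresidual.
exact: mbmeas_cst.
Qed.

Lemma mbmeas_error_op : mbmeas unitary_set error_op.
Proof.
apply: mbmeasB; last exact: mbmeas_correction.
apply: mbmeasB; first exact: mbmeas_cst.
apply: mbmeasM; last exact: mbmeas_id.
by apply: mbmeasM; [exact/mbmeas_trmxC/mbmeas_id|exact: mbmeas_cst].
Qed.

(** The square of M - X - L is expanded and regrouped by how it will be averaged: terms linear in
    [target_corr], which have mean zero, products of two [target_corr], which fall under the second
    moment, and Tr(L^2), left whole because only its sign will matter. *)
Lemma error_op_norm (u : cmx R q) : unitary_set u ->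
  \tr (error_op u *m error_op u) + \tr (error_op u) ^+ 2 =
  (2 * \tr (Obs *m Obs) - 2 * target_corr M u) +
  \sum_a 2 * (\tr (M *m herm_part (sigma a)) * target_corr (Lam a) u
    - target_corr (herm_part (sigma a)) u * target_corr (Lam a) u) +
  \tr (correction u *m correction u).
Proof.
move=> uu; set X := (u : 'M[R[i]]_q) ^t* *m Obs *m (u : 'M[R[i]]_q).
have trX : \tr X = 0 by rewrite /X mxtrace_mulC mulmxA (unitarymxP uu) mul1mx.
have trXX : \tr (X *m X) = \tr (Obs *m Obs).
  rewrite /X !mulmxA mulmxtVK//.
  by rewrite mxtrace_mulC !mulmxA (unitarymxP uu) mul1mx.
have trL : \tr (correction u) = 0.
  by rewrite /correction raddf_sum big1// => a _; rewrite /= mxtraceZ Lam_tr0 mulr0.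
have trML : \tr (M *m correction u) = 0.
  rewrite /correction mulmx_sumr raddf_sum big1// => a _.
  by rewrite /= -scalemxAr mxtraceZ Lam_M mulr0.
have trXL : \tr (X *m correction u) = \sum_a cresidual u a * target_corr (Lam a) u.
  rewrite /correction mulmx_sumr raddf_sum; apply: eq_bigr => a _ /=.
  by rewrite -scalemxAr mxtraceZ target_corr_cyc.
have -> : \tr (error_op u) = 0.
  by rewrite /error_op -/X !raddfB /= M_tr0 trX trL !subr0.
rewrite mxtrace_sqrB3 -/X (mxtrace_mulC M X).
rewrite trML trXL M_tr2 trXX -target_corr_cyc.
under [in RHS]eq_bigr do rewrite -mulrBl.
rewrite -mulr_sumr; ring.
Qed.

(** The remainder [e] is the mean of Tr(L^2). Recording that it vanishes with [Lam] lets one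
    statement give both the equality for the initial error and the inequality for the final one. *)
Lemma target_moment : exists e : R,
  [/\ 0 <= e, (forall a, Lam a = 0) -> e = 0 &
  complex.Re (Cint mu (fun u => \tr (error_op u *m error_op u) + \tr (error_op u) ^+ 2)) =
  2 * complex.Re (\tr (Obs *m Obs)) -
  2 * (complex.Re (\tr (Obs *m Obs)) / (q%:R ^+ 2 - 1)) *
     \sum_a complex.Re (\tr (Lam a *m sigma a)) + e].
Proof.
exists (complex.Re (Cint mu (fun u => \tr (correction u *m correction u)))); split.
- apply: Re_Cint_ge0 => u.
  by have := mxtrace_hermitian_sqr_ge0 (correction_herm u); rewrite lecE => /andP[].
- move=> L0; rewrite (_ : (fun u => _) = (fun=> 0)); first by rewrite Cint_cst.
  apply/funext => u; rewrite /correction big1 ?mul0mx ?mxtrace0// => a _.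
  by rewrite L0 scaler0.
- have bT A := bmeas_target_corr A.
  have bLL : bmeas unitary_set (fun u => \tr (correction u *m correction u)).
    by apply: bmeas_mxtrace; apply: mbmeasM; exact: mbmeas_correction.
  have bMT a : bmeas unitary_set (fun u => \tr (M *m herm_part (sigma a)) * target_corr (Lam a) u).
    by apply: bmeasM => //; exact: bmeas_cst.
  have bTT a : bmeas unitary_set
      (fun u => target_corr (herm_part (sigma a)) u * target_corr (Lam a) u).
    exact: bmeasM.
  have b1 : bmeas unitary_set (fun u => 2 * \tr (Obs *m Obs) - 2 * target_corr M u).
    apply: bmeasB; first exact: bmeas_cst.
    by apply: bmeasM => //; exact: bmeas_cst.
  have b2 a : bmeas unitary_set (fun u =>
      2 * (\tr (M *m herm_part (sigma a)) * target_corr (Lam a) u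
        - target_corr (herm_part (sigma a)) u * target_corr (Lam a) u)).
    by apply: bmeasM; [exact: bmeas_cst|exact: bmeasB].
  rewrite (eq_Cint mU mu1 _ _ error_op_norm); last 2 first.
  - apply: (bmeas_set0 (D := unitary_set)); apply: bmeasD.
      by apply: bmeas_mxtrace; apply: mbmeasM; exact: mbmeas_error_op.
    by apply: bmeasM; apply: bmeas_mxtrace; exact: mbmeas_error_op.
  - apply: (bmeas_set0 (D := unitary_set)); apply: bmeasD => //; apply: bmeasD => //.
    exact: bmeas_sum.
  rewrite (CintD mU mu1)//; last by apply: bmeasD => //; exact: bmeas_sum.
  rewrite (CintD mU mu1)//; last exact: bmeas_sum.
  rewrite (CintB mU mu1); last 2 first.
  - exact: bmeas_cst.
  - by apply: bmeasM => //; exact: bmeas_cst.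
  rewrite Cint_cst (CintZ mU mu1)// target_first_moment mulr0 subr0.
  rewrite (Cint_sum mU mu1)//.
  have cE a : Cint mu (fun u => 2 * (\tr (M *m herm_part (sigma a)) * target_corr (Lam a) u
        - target_corr (herm_part (sigma a)) u * target_corr (Lam a) u)) =
      - (2 * \tr (Obs *m Obs)) * (complex.Re (\tr (Lam a *m sigma a)) / (q%:R ^+ 2 - 1))%:C%C.
    rewrite (CintZ mU mu1); last exact: bmeasB.
    rewrite (CintB mU mu1)// (CintZ mU mu1)// target_first_moment mulr0 sub0r.
    rewrite target_second_moment// (mxtrace_mulC (herm_part _)) -Re_mxtrace_herm//.
    rewrite rmorphM fmorphV rmorphB rmorphXn rmorph1 /= rmorph_nat; ring.
  rewrite (eq_bigr _ (fun a _ => cE a)) -mulr_sumr -rmorph_sum -mulr_suml /=.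
  have ReD (z w : R[i]) : complex.Re (z + w) = complex.Re z + complex.Re w.
    by case: z w => ? ? [].
  rewrite !ReD Re_mul_real; congr (_ + _ + _).
    by case: (\tr (Obs *m Obs)) => a b /=; ring.
  by case: (\tr (Obs *m Obs)) => a b /=; ring.
Qed.

End TargetMoment.

(** * The squared test error conditioned on the training states *)

Section ExpectedError.
Variables (R : realType) (d : measure_display) (T : measurableType d)
  (P : probability T R) (N : nat).
Hypothesis N_gt0 : (0 < N)%N.
Local Notation q := (2 ^ N)%N.
Variables (m n : nat) (rho : 'I_(m + n) -> {RV P >-> cmx R q}) (U : {RV P >-> cmx R q}).
Hypotheses (rho_design : forall i, state_2design (distribution P (rho i)))
  (U_design : unitary_2design (distribution P U)).
Let X (o : option 'I_(m + n)) (w : T) : cmx R q := if o is Some i then rho i w else U w.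
Hypothesis indep : mutually_independent P X.
Variables (Obs M : 'M[R[i]]_q) (Lam : ('I_m -> 'M[R[i]]_q) -> 'I_m -> 'M[R[i]]_q).
Hypotheses (Obs_herm : Obs \is hermsymmx) (Obs_tr0 : \tr Obs = 0).
Hypotheses (M_herm : M \is hermsymmx) (M_tr0 : \tr M = 0)
  (M_tr2 : \tr (M *m M) = \tr (Obs *m Obs)).
Hypotheses (Lam_herm : forall s a, Lam s a \is hermsymmx)
  (Lam_tr0 : forall s a, \tr (Lam s a) = 0)
  (Lam_M : forall s a, \tr (M *m Lam s a) = 0).
Hypothesis Lam_meas : forall (d' : measure_display) (S : measurableType d')
  (s : 'I_m -> S -> cmx R q), (forall a, measurable_fun setT (s a)) ->
  forall a, mbmeas set0 (fun x => Lam (fun k => s k x) a).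

Let train (w : T) (a : 'I_m) : 'M[R[i]]_q := rho (lshift n a) w.
Let Z (w : T) (u : cmx R q) := error_op Obs M (train w) (Lam (train w)) u.

(** The base space is arbitrary because the error operator is needed as a function on [T] and on the
    products of [sub_space] with the matrix space, for two different sets [J]. *)
Lemma mbmeas_error_op_param (d' : measure_display) (S : measurableType d')
    (s : 'I_m -> S -> cmx R q) (u : S -> cmx R q) :
  (forall a, measurable_fun setT (s a)) -> measurable_fun setT u ->
  mbmeas set0 (fun x => error_op Obs M (fun k => s k x) (Lam (fun k => s k x)) (u x)).
Proof.
move=> ms /measurable_cmxP mu.
have cst A : mbmeas set0 (fun _ : S => A : 'M[R[i]]_q) by exact: mbmeas_cst.
have mcu := mbmeas_trmxC mu.
have mh a : mbmeas set0 (fun x => herm_part (s a x)).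
  have msa := (measurable_cmxP (s a)).1 (ms a).
  apply: mbmeasZ; first exact: bmeas_cst.
  by apply: mbmeasD => //; exact: mbmeas_trmxC.
apply: mbmeasB.
  apply: mbmeasB; first exact: cst.
  apply: mbmeasM => //; exact: mbmeasM.
apply: mbmeas_sum => a; apply: mbmeasZ; last exact: Lam_meas.
apply: bmeasB; apply: bmeas_mxtrace; first exact: mbmeasM.
by apply: mbmeasM => //; apply: mbmeasM => //; exact: mbmeasM.
Qed.

Let mX o : measurable_fun setT (X o).
Proof. by case: o => [i|]; exact: measurable_funPT. Qed.

Variable b : 'I_n.

Definition test_error (w : T) : R :=
  complex.Re (\tr (Z w (U w) *m (rho (rshift m b) w : 'M[R[i]]_q))).

Lemma measurable_test_error : measurable_fun setT test_error.
Proof.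
have [] // : bmeas set0 (fun w => \tr (Z w (U w) *m (rho (rshift m b) w : 'M[R[i]]_q))).
apply: bmeas_mxtrace; apply: mbmeasM; last by apply/measurable_cmxP; exact: measurable_funPT.
by apply: mbmeas_error_op_param => [a|]; exact: measurable_funPT.
Qed.

Let S (w : T) (u : cmx R q) : R[i] := \tr (Z w u *m Z w u) + \tr (Z w u) ^+ 2.
Let alpha : R := (q%:R * (q%:R + 1))^-1.

Let Z_herm w u : Z w u \is hermsymmx.
Proof. exact: error_op_herm. Qed.

Let S_ge0 w u : 0 <= complex.Re (S w u).
Proof.
have hZ := Z_herm w u.
have h1 := mxtrace_hermitian_sqr_ge0 hZ.
have h2 : 0 <= \tr (Z w u) ^+ 2.
  have := mxtrace_hermitian_mul hZ (hermitian1mx_subproof _); rewrite mulmx1 => /CrealP r.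
  by rewrite real_exprn_even_ge0.
have : 0 <= S w u by exact: addr_ge0.
by rewrite lecE => /andP[].
Qed.

Let integrate_state :
  (\int[P]_w (test_error w ^+ 2)%:E = \int[P]_w (complex.Re (S w (U w)) * alpha)%:E)%E.
Proof.
(* Everything but the test state [b] is frozen. The error operator involves the training states and
   [U] only, so it is a constant Hermitian matrix for the inner integral. *)
pose i0 : option 'I_(m + n) := Some (rshift m b); pose J := ~: [set i0].
have i0J : i0 \notin J by rewrite !inE eqxx.
pose f (z : sub_space X J * cmx R q) : \bar R :=
  ((complex.Re (\tr (Z z.1 (U z.1) *m (z.2 : 'M[R[i]]_q)))) ^+ 2)%:E.
have coord o : o != i0 -> measurable_fun setT (fun z : sub_space X J * cmx R q => X o z.1).
  move=> oi; have oJ : o \in J by rewrite !inE.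
  have h : measurable_fun setT (X o : sub_space X J -> cmx R q) := measurable_sub_coord oJ.
  exact: (measurableT_comp h measurable_fst).
have mf : measurable_fun setT f.
  have [h _ _] : bmeas set0 (fun z : sub_space X J * cmx R q =>
      \tr (Z z.1 (U z.1) *m (z.2 : 'M[R[i]]_q))).
    apply: bmeas_mxtrace; apply: mbmeasM; last first.
      by apply/measurable_cmxP; exact: measurable_snd.
    apply: (mbmeas_error_op_param
      (s := fun a (z : sub_space X J * cmx R q) => X (Some (lshift n a)) z.1)
      (u := fun z : sub_space X J * cmx R q => X None z.1)) => [a|].
      by apply: coord; rewrite (inj_eq Some_inj) eq_lrshift.
    exact: coord.
  by apply/measurable_EFinP; apply: measurable_funX.
have f0 z : (0 <= f z)%E by rewrite lee_fin sqr_ge0.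
have := freezing mX indep i0J (erefl : X i0 = rho (rshift m b)) mf f0.
rewrite /f /= => ->; apply: eq_integral => w _.
by rewrite (state_moment N_gt0 (rho_design _) (Z_herm w (U w))).
Qed.

Lemma expected_error : exists g : T -> R,
  [/\ measurable_fun setT g, forall w, 0 <= g w,
    (\int[P]_w (test_error w ^+ 2)%:E = \int[P]_w (g w)%:E)%E &
    forall w, exists e, [/\ 0 <= e, (forall s a, Lam s a = 0) -> e = 0 &
      g w = alpha * (2 * complex.Re (\tr (Obs *m Obs)) -
        2 * (complex.Re (\tr (Obs *m Obs)) / (q%:R ^+ 2 - 1)) *
          (\sum_a complex.Re (\tr (Lam (train w) a *m train w a))) + e)]].
Proof.
(* Once the test state is gone, the integrand depends on the training states and [U], so freezing
   the training states suffices to integrate [U] out. *)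
pose i0 : option 'I_(m + n) := None.
pose J : {set option 'I_(m + n)} := [set Some (lshift n a) | a : 'I_m].
have i0J : i0 \notin J by apply/imsetP => -[].
pose f (z : sub_space X J * cmx R q) : \bar R :=
  (complex.Re (S z.1 (z.2 : cmx R q)) * alpha)%:E.
have alpha0 : 0 <= alpha by rewrite invr_ge0 mulr_ge0// addr_ge0.
have mf : measurable_fun setT f.
  have mZ : mbmeas set0 (fun z : sub_space X J * cmx R q => Z z.1 (z.2 : cmx R q)).
    apply: (mbmeas_error_op_param
      (s := fun a (z : sub_space X J * cmx R q) => X (Some (lshift n a)) z.1)
      (u := fun z : sub_space X J * cmx R q => z.2)) => [a|]; last exact: measurable_snd.
    have oJ : Some (lshift n a) \in J by apply/imsetP; exists a.
    have h : measurable_fun setT (X (Some (lshift n a)) : sub_space X J -> cmx R q) :=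
      measurable_sub_coord oJ.
    exact: (measurableT_comp h measurable_fst).
  have [h _ _] : bmeas set0 (fun z : sub_space X J * cmx R q => S z.1 (z.2 : cmx R q)).
    apply: bmeasD; first by apply: bmeas_mxtrace; exact: mbmeasM.
    by apply: bmeasM; exact: bmeas_mxtrace.
  apply/measurable_EFinP; apply: measurable_funM => //; exact: measurable_cst.
have f0 z : (0 <= f z)%E by rewrite lee_fin mulr_ge0// S_ge0.
have fE := freezing mX indep i0J (erefl : X i0 = U) mf f0.
have fM := measurable_freezing mX U mf f0.
pose g w := alpha * complex.Re (Cint (distribution P U) (S w)).
have bS w : bmeas unitary_set (S w).
  have mZ : mbmeas unitary_set (Z w) by exact: mbmeas_error_op.
  apply: bmeasD; first by apply: bmeas_mxtrace; exact: mbmeasM.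
  by apply: bmeasM; exact: bmeas_mxtrace.
have mU := @measurable_unitary_set R q; have [U1 _] := U_design.
have gE w : (\int[distribution P U]_u f ((w : sub_space X J), u) = (g w)%:E)%E.
  have -> : g w = complex.Re (Cint (distribution P U) (fun u => alpha%:C%C * S w u)).
    by rewrite (CintZ mU U1)// mulrC Re_mul_real mulrC.
  rewrite -(Re_Cint mU U1); last by apply: bmeasM => //; exact: bmeas_cst.
  by apply: eq_integral => u _; rewrite /f /= (mulrC alpha%:C%C) Re_mul_real.
exists g; split.
- by apply/measurable_EFinP; move: fM; congr measurable_fun; apply/funext => w; exact: gE.
- by move=> w; apply: mulr_ge0 => //; apply: Re_Cint_ge0 => u; exact: S_ge0.
- rewrite integrate_state; rewrite /f /= in fE; rewrite fE.
  by apply: eq_integral => w _; exact: gE.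
- move=> w; have [e [e0 eL eE]] := target_moment N_gt0 U_design Obs_herm Obs_tr0
    (train w) M_herm M_tr0 M_tr2 (Lam_herm (train w)) (Lam_tr0 (train w)) (Lam_M (train w)).
  by exists e; split => //; [move=> L0; apply: eL => a; exact: L0|rewrite /g eE].
Qed.

End ExpectedError.

(** * The frozen kernel *)

Section RealMatrixMeasurability.
Variables (R : realType) (d : measure_display) (S : measurableType d).

Lemma measurable_invr : measurable_fun setT (@GRing.inv R).
Proof.
have -> : [set: R] = [set x | x != 0] `|` [set 0].
  by apply/seteqP; split => x //= _; have [->|x0] := eqVneq x 0; [right|left].
have o : open [set x : R | x != 0] by exact: open_neq.
apply/measurable_funU => //; first exact: open_measurable.
split; last exact: measurable_fun_set1.
by apply: open_continuous_measurable_fun => // x; rewrite inE => /inv_continuous.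
Qed.

Lemma measurable_det n (A : S -> 'M[R]_n) :
  (forall i j, measurable_fun setT (fun x => A x i j)) ->
  measurable_fun setT (fun x => \det (A x)).
Proof.
move=> mA; apply: measurable_sum => s; apply: measurable_funM.
  exact: measurable_cst.
by apply: measurable_prod => i _.
Qed.

Lemma measurable_invmx n (A : S -> 'M[R]_n) i j :
  (forall i j, measurable_fun setT (fun x => A x i j)) ->
  measurable_fun setT (fun x => invmx (A x) i j).
Proof.
move=> mA; have mdet := measurable_det mA.
(* [invmx] returns the matrix itself when the determinant vanishes; elsewhere Cramer's rule
   applies. *)
rewrite (_ : (fun x => _) = fun x => if \det (A x) == 0 then A x i j
    else (\det (A x))^-1 * cofactor (A x) j i); last first.
  apply/funext => x; rewrite /invmx unitmxE unitfE; case: eqP => //= _.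
  by rewrite !mxE.
apply: measurable_fun_ifT => //.
  by apply: measurable_fun_eqr => //; exact: measurable_cst.
apply: measurable_funM; first exact: (measurableT_comp measurable_invr).
apply: measurable_funM; first exact: measurable_cst.
apply: measurable_det => k l; under eq_fun do rewrite !mxE; exact: mA.
Qed.

End RealMatrixMeasurability.

Section Loss.
Variables (R : realType) (d : measure_display) (T : measurableType d)
  (P : probability T R).

Lemma expectation_loss n (e : 'I_n -> T -> R) :
  (forall b, measurable_fun setT (e b)) ->
  ('E_P[fun w => loss (e ^~ w)] =
   ((2 * n%:R)^-1)%:E * \sum_(b < n) \int[P]_w (e b w ^+ 2)%:E)%E.
Proof.
move=> me; rewrite unlock /loss.
have me2 b : measurable_fun setT (fun w => (e b w ^+ 2)%:E).
  by apply/measurable_EFinP; exact: measurable_funX.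
have e0 (b : 'I_n) (w : T) : [set: T] w -> (0 <= (e b w ^+ 2)%:E)%E.
  by rewrite lee_fin sqr_ge0.
rewrite -(ge0_integral_sum P measurableT me2 e0).
rewrite -ge0_integralZl_EFin//.
- by apply: eq_integral => w _; rewrite EFinM sumEFin.
- by move=> w _; apply: sume_ge0 => b _; rewrite lee_fin sqr_ge0.
- exact: emeasurable_sum.
Qed.

Lemma ae_le_integral_cst (c : R) (g : T -> R) : measurable_fun setT g ->
  (forall w, 0 <= g w) -> {ae P, forall w, c <= g w} ->
  (c%:E <= \int[P]_w (g w)%:E)%E.
Proof.
(* In the application [c] is negative when the training set has more than 4^N - 1 states and [Obs]
   is nonzero. Truncating it at 0, which is harmless as [g] is nonnegative, makes monotonicity of
   nonnegative integrals available. *)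
move=> mg g0 cg; apply: (@le_trans _ _ (Num.max c 0)%:E).
  by rewrite lee_fin le_max lexx.
have <- : (\int[P]_w (cst (Num.max c 0)%:E w) = (Num.max c 0)%:E)%E.
  by rewrite integral_cst// [X in (_ * X)%E]probability_setT mule1.
apply: ae_ge0_le_integral => //.
- by move=> w _ /=; rewrite lee_fin le_max lexx orbT.
- by move=> w _; rewrite lee_fin.
- exact/measurable_EFinP.
- by apply: filterS cg => w cw _; rewrite lee_fin ge_max cw g0.
Qed.

End Loss.

Section ErrorOp.
Variables (R : realType) (N : nat) (I : finType).
Local Notation q := (2 ^ N)%N.
Variables (Obs M : 'M[R[i]]_q) (sigma Lam : I -> 'M[R[i]]_q) (u : cmx R q).
Hypotheses (Obs_herm : Obs \is hermsymmx) (M_herm : M \is hermsymmx).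

Let ReB (z w : R[i]) : complex.Re (z - w) = complex.Re z - complex.Re w.
Proof. by case: z w => ? ? []. Qed.

Lemma labelE (x : 'M[R[i]]_q) : label Obs u x =
  complex.Re (\tr ((u : 'M[R[i]]_q) ^t* *m Obs *m (u : 'M[R[i]]_q) *m x)).
Proof. by rewrite /label mxtrace_mulC !mulmxA. Qed.

Lemma cresidualE a : cresidual Obs M sigma u a =
  (complex.Re (\tr (M *m sigma a)) - label Obs u (sigma a))%:C%C.
Proof.
rewrite labelE rmorphB /= (Re_mxtrace_herm _ M_herm).
by rewrite (Re_mxtrace_herm _ (hermsymmx_conj _ Obs_herm)) /cresidual target_corr_cyc.
Qed.

Lemma Re_error_op (x : 'M[R[i]]_q) :
  complex.Re (\tr (error_op Obs M sigma Lam u *m x)) =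
  complex.Re (\tr (M *m x)) - label Obs u x -
  \sum_a (complex.Re (\tr (M *m sigma a)) - label Obs u (sigma a)) *
    complex.Re (\tr (Lam a *m x)).
Proof.
have trB (A B : 'M[R[i]]_q) : \tr (A - B) = \tr A - \tr B by exact: raddfB.
rewrite labelE /error_op !mulmxBl !trB !ReB; congr (_ - _).
rewrite /correction mulmx_suml [\tr (\sum_a _)]raddf_sum.
have ReD (z w : R[i]) : complex.Re (z + w) = complex.Re z + complex.Re w by case: z w => ? ? [].
rewrite (big_morph _ ReD (erefl : complex.Re 0 = 0 :> R)).
apply: eq_bigr => a _ /=; rewrite -scalemxAl mxtraceZ mulrC cresidualE Re_mul_real.
by rewrite mulrC.
Qed.

End ErrorOp.

Section KernelCorrection.
Variables (R : realType) (q D m : nat) (G : 'I_D -> 'M[R[i]]_q).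
Hypothesis G_herm : forall l, G l \is hermsymmx.
Implicit Types (s : 'I_m -> 'M[R[i]]_q).

Let grad (l : 'I_D) (x : 'M[R[i]]_q) : R := complex.Re (\tr (G l *m x)).

Definition train_kernel s : 'M[R]_m :=
  \matrix_(a, a') (D%:R^-1 * \sum_(l < D) grad l (s a) * grad l (s a')).

(** The kernel is bilinear in the two states, so the test state can be factored out: the trace of
    this operator against x has real part equal to the sum over a' of K(x, s_a') [K^-1]_a'a. *)
Definition kernel_op s (a : 'I_m) : 'M[R[i]]_q :=
  \sum_(a' < m) \sum_(l < D)
    (invmx (train_kernel s) a' a * D%:R^-1 * grad l (s a'))%:C%C *: G l.

Lemma kernel_op_herm s a : kernel_op s a \is hermsymmx.
Proof.
apply: hermsymmx_sum => a'; apply: hermsymmx_sum => l.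
by apply: hermsymmxZ; [exact: conjc_real|exact: G_herm].
Qed.

Lemma mxtrace_kernel_op (B : 'M[R[i]]_q) s a : (forall l, \tr (B *m G l) = 0) ->
  \tr (B *m kernel_op s a) = 0.
Proof.
move=> B0; rewrite /kernel_op mulmx_sumr raddf_sum big1// => a' _ /=.
rewrite mulmx_sumr raddf_sum big1// => l _ /=.
by rewrite -scalemxAr mxtraceZ B0 mulr0.
Qed.

Lemma Re_kernel_op s a (x : 'M[R[i]]_q) :
  complex.Re (\tr (kernel_op s a *m x)) =
  \sum_(a' < m) (D%:R^-1 * \sum_(l < D) grad l x * grad l (s a')) * invmx (train_kernel s) a' a.
Proof.
have ReD (z w : R[i]) : complex.Re (z + w) = complex.Re z + complex.Re w.
  by case: z w => ? ? [].
have ReS := big_morph _ ReD (erefl : complex.Re 0 = 0 :> R).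
rewrite /kernel_op mulmx_suml [\tr (\sum_a _)]raddf_sum ReS; apply: eq_bigr => a' _ /=.
rewrite mulmx_suml [\tr (\sum_a _)]raddf_sum ReS mulr_sumr mulr_suml.
apply: eq_bigr => l _ /=.
by rewrite -scalemxAl mxtraceZ mulrC Re_mul_real -/(grad l x); ring.
Qed.

(** Evaluated at its own training state, the operator of index [a] gives the diagonal entry of K
    K^-1, and the sum is the trace of the identity. This is where invertibility of the kernel
    enters. *)
Lemma Re_kernel_op_train s : train_kernel s \in unitmx ->
  \sum_(a < m) complex.Re (\tr (kernel_op s a *m s a)) = m%:R.
Proof.
move=> uK; rewrite -[RHS]mxtrace1 -(mulmxV uK); apply: eq_bigr => a _.
by rewrite Re_kernel_op mxE; apply: eq_bigr => a' _; rewrite [in RHS]mxE.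
Qed.

Lemma mbmeas_kernel_op (d : measure_display) (S : measurableType d)
    (s : 'I_m -> S -> cmx R q) : (forall a, measurable_fun setT (s a)) ->
  forall a, mbmeas set0 (fun x => kernel_op (fun k => s k x) a).
Proof.
move=> ms a.
have mgrad l a' : measurable_fun setT (fun x => grad l (s a' x)).
  have [] // : bmeas set0 (fun x => \tr (G l *m (s a' x : 'M[R[i]]_q))).
  apply: bmeas_mxtrace; apply: mbmeasM; first exact: mbmeas_cst.
  exact/measurable_cmxP.
have mK a1 a2 : measurable_fun setT (fun x => train_kernel (fun k => s k x) a1 a2).
  under eq_fun do rewrite mxE.
  apply: measurable_funM; first exact: measurable_cst.
  by apply: measurable_sum => l; exact: measurable_funM.
apply: mbmeas_sum => a'; apply: mbmeas_sum => l; apply: mbmeasZ; last exact: mbmeas_cst.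
apply: bmeas_real; last by exists 0.
apply: measurable_funM => //; apply: measurable_funM; last exact: measurable_cst.
exact: measurable_invmx.
Qed.

End KernelCorrection.

Theorem theorem2 (R : realType) (d : measure_display) (T : measurableType d)
  (P : probability T R)
  (N : nat) (N_gt0 : (0 < N)%N)
  (* circuit: D layers, generators H, fixed unitaries W, initial parameter *)
  (D : nat) (H W : 'I_D -> 'M[R[i]]_(2 ^ N)) (theta0 : 'rV[R]_D)
  (H_herm : forall l, H l \is hermsymmx)
  (H_unitary : forall l, H l \is unitarymx)
  (W_unitary : forall l, W l \is unitarymx)
  (* traceless observable *)
  (Obs : 'M[R[i]]_(2 ^ N)) (Obs_herm : Obs \is hermsymmx) (Obs_tr0 : \tr Obs = 0)
  (* m = |A| training states, n = |B| test states, and the target unitary *)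
  (m n : nat)
  (rho : 'I_(m + n) -> {RV P >-> cmx R (2 ^ N)})
  (U : {RV P >-> cmx R (2 ^ N)})
  (rho_design : forall i, state_2design (distribution P (rho i)))
  (U_design : unitary_2design (distribution P U))
  (indep : mutually_independent P
     (fun (o : option 'I_(m + n)) (w : T) =>
        if o is Some i then rho i w else U w))
  (K_inv : {ae P, forall w,
     ulsubmx (qntk Obs H W theta0 (fun i => rho i w)) \in unitmx})
  (* test predictions at the end of training *)
  (z_inf : 'I_n -> T -> R)
  (frozen : forall b w,
     z_inf b w =
     frozen_prediction (qntk Obs H W theta0 (fun i => rho i w))
       (fun i => prediction Obs H W theta0 (rho i w))
       (fun i => residual Obs H W theta0 (U w) (rho i w)) b) :
  ((1 - m%:R / (2 ^+ (2 * N) - 1))%R%:E *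
     'E_P[(fun w => loss (fun b : 'I_n =>
             residual Obs H W theta0 (U w) (rho (rshift m b) w)))%R]
   <=
   'E_P[(fun w => loss (fun b : 'I_n =>
           z_inf b w - label Obs (U w) (rho (rshift m b) w)))%R])%E.
Proof.
have [G hG] := fin_all_exists
  (heisenberg_derivative theta0 H_herm H_unitary W_unitary Obs_herm Obs_tr0).
pose M := heisenberg H W Obs theta0.
have G_herm l : G l \is hermsymmx by case: (hG l).
have G_tr0 l : \tr (G l) = 0 by case: (hG l).
have G_M l : \tr (M *m G l) = 0 by case: (hG l).
have gradE l x : dprediction Obs H W theta0 l x = complex.Re (\tr (G l *m x)) by case: (hG l).
have M_herm : M \is hermsymmx by exact: heisenberg_herm.
have M_tr0 : \tr M = 0 by exact: heisenberg_tr.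
have M_tr2 : \tr (M *m M) = \tr (Obs *m Obs) by exact: heisenberg_tr2.
pose train w a : 'M[R[i]]_(2 ^ N) := rho (lshift n a) w.
pose Lam (s : 'I_m -> 'M[R[i]]_(2 ^ N)) := kernel_op G s.
have Lam_herm s a : Lam s a \is hermsymmx by exact: kernel_op_herm.
have Lam_M s a : \tr (M *m Lam s a) = 0 by exact: mxtrace_kernel_op.
have Lam_tr0 s a : \tr (Lam s a) = 0.
  by rewrite -[Lam s a]mul1mx mxtrace_kernel_op// => l; rewrite mul1mx.
have Lam_meas (d' : measure_display) (S : measurableType d') (s : 'I_m -> S -> cmx R (2 ^ N)) :
    (forall a, measurable_fun setT (s a)) ->
    forall a, mbmeas set0 (fun x => Lam (fun k => s k x) a).
  exact: mbmeas_kernel_op.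
have KE w : ulsubmx (qntk Obs H W theta0 (fun i => rho i w)) = train_kernel G (train w).
  by apply/matrixP => a a'; rewrite !mxE; under eq_bigr do rewrite !gradE.
(* With zero correction operators the error operator is M - X, whose expectation in a test state is
   the initial residual; the general averaging lemma thus also evaluates the initial loss. *)
pose Lam0 (s : 'I_m -> 'M[R[i]]_(2 ^ N)) (a : 'I_m) : 'M[R[i]]_(2 ^ N) := 0.
have Lam0_herm s a : Lam0 s a \is hermsymmx.
  by apply/hermsymmxP; rewrite /Lam0 trmx0 map_mx0.
have Lam0_M s a : \tr (M *m Lam0 s a) = 0 by rewrite mulmx0 mxtrace0.
have Lam0_tr0 s a : \tr (Lam0 s a) = 0 by exact: mxtrace0.
have Lam0_meas (d' : measure_display) (S : measurableType d') (s : 'I_m -> S -> cmx R (2 ^ N)) :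
    (forall a, measurable_fun setT (s a)) ->
    forall a, mbmeas set0 (fun x => Lam0 (fun k => s k x) a).
  by move=> _ a; exact: mbmeas_cst.
(* The identity holds at every sample point, including those with a singular kernel, because
   [kernel_op] and [frozen_prediction] use the same [invmx]. *)
have errE b w : test_error rho U Obs M Lam b w =
    z_inf b w - label Obs (U w) (rho (rshift m b) w).
  rewrite /test_error Re_error_op// frozen /frozen_prediction predictionE.
  rewrite addrAC; congr (_ - _ - _); apply: eq_bigr => a _.
  rewrite Re_kernel_op mulr_sumr; apply: eq_bigr => a' _.
  rewrite KE /residual predictionE mxE mulrC; congr (_ * _ * _).
  by congr (_ * _); apply: eq_bigr => l _; rewrite !gradE.
have err0E b w : test_error rho U Obs M Lam0 b w =
    residual Obs H W theta0 (U w) (rho (rshift m b) w).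
  rewrite /test_error Re_error_op// big1 ?subr0// => a _.
  by rewrite mul0mx mxtrace0 mulr0.
set q : R := (2 ^ N)%:R; pose t := complex.Re (\tr (Obs *m Obs)).
pose alpha := (q * (q + 1))^-1.
have q1 : 1 < q := dim_gt1 R N_gt0.
have alpha0 : 0 <= alpha by rewrite invr_ge0 mulr_ge0 ?addr_ge0// ltW// (lt_trans _ q1).
have initial b : (\int[P]_w (test_error rho U Obs M Lam0 b w ^+ 2)%:E = (alpha * (2 * t))%:E)%E.
  have [g [mg g0 -> gE]] := expected_error N_gt0 rho_design U_design indep Obs_herm Obs_tr0
    M_herm M_tr0 M_tr2 Lam0_herm Lam0_tr0 Lam0_M Lam0_meas b.
  have {}gE w : g w = alpha * (2 * t).
    have [e [_ /(_ (fun _ _ => erefl)) -> ->]] := gE w.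
    by rewrite big1 ?mulr0 ?subr0 ?addr0// => a _; rewrite mul0mx mxtrace0.
  under eq_integral do rewrite gE.
  by rewrite integral_cst// [X in (_ * X)%E]probability_setT mule1.
(* The nonnegative remainder is dropped, and almost surely the sum of the traces Tr[Lam_a rho_a] is
   m; what is left no longer depends on the training states. *)
have final b : ((alpha * (2 * t - 2 * (t / (q ^+ 2 - 1)) * m%:R))%:E <=
    \int[P]_w (test_error rho U Obs M Lam b w ^+ 2)%:E)%E.
  have [g [mg g0 -> gE]] := expected_error N_gt0 rho_design U_design indep Obs_herm Obs_tr0
    M_herm M_tr0 M_tr2 Lam_herm Lam_tr0 Lam_M Lam_meas b.
  apply: ae_le_integral_cst => //; apply: filterS K_inv => w; rewrite KE => uK.
  have [e [e0 _ ->]] := gE w.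
  by rewrite (Re_kernel_op_train uK) ler_wpM2l// lerDl.
have mtest L : (forall (d' : measure_display) (S : measurableType d')
    (s : 'I_m -> S -> cmx R (2 ^ N)),
    (forall a, measurable_fun setT (s a)) ->
    forall a, mbmeas set0 (fun x => L (fun k => s k x) a)) ->
  forall b, measurable_fun setT (test_error rho U Obs M L b).
  by move=> mL b; exact: measurable_test_error.
have e0 : ('E_P[(fun w => loss (fun b : 'I_n =>
      residual Obs H W theta0 (U w) (rho (rshift m b) w)))%R] =
    ((2 * n%:R)^-1)%:E * \sum_(b < n) (alpha * (2 * t))%:E)%E.
  rewrite (_ : (fun w => _) = fun w => loss (test_error rho U Obs M Lam0 ^~ w)); last first.
    by apply/funext => w; congr loss; apply/funext => b; rewrite err0E.
  rewrite expectation_loss; last exact: mtest Lam0_meas.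
  by congr (_ * _)%E; apply: eq_bigr => b _; exact: initial.
have e1 : (((2 * n%:R)^-1)%:E *
    \sum_(b < n) (alpha * (2 * t - 2 * (t / (q ^+ 2 - 1)) * m%:R))%:E <=
    'E_P[(fun w => loss (fun b : 'I_n =>
      z_inf b w - label Obs (U w) (rho (rshift m b) w)))%R])%E.
  rewrite (_ : (fun w => _) = fun w => loss (test_error rho U Obs M Lam ^~ w)); last first.
    by apply/funext => w; congr loss; apply/funext => b; rewrite errE.
  rewrite expectation_loss; last exact: mtest Lam_meas.
  apply: lee_wpmul2l; first by rewrite lee_fin invr_ge0 mulr_ge0.
  by apply: lee_sum => b _; exact: final.
rewrite e0; apply: le_trans e1.
have -> : 2 ^+ (2 * N) = q ^+ 2 :> R by rewrite /q natrX -exprM mulnC.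
rewrite !sumEFin -!EFinM lee_fin !sumr_const card_ord.
(* The two sides are equal: every inequality has already been spent in [final]. *)
by rewrite le_eqVlt; apply/orP; left; apply/eqP; ring.
Qed.
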